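(* Let $S$ be a finite inverse semigroup. Then $$\theta_S=\prod_{i=1}^rP_i^{d_i}$$ where the $P_i$ are distinct irreducible homogeneous polynomials of degree $d_i$. Here $r$ is the number of conjugacy classes of $S$, the $d_i$ are the degrees of the irreducible representations of $S$ and the $P_i$ determine the irreducible characters of $S$. More precisely, for $s\in S$, put $y_s=\sum_{t\leq s}\mu_S(t,s)x_t$ and put $Y=\{y_s\mid s\in S\}$. Then $\theta_S(X)=\theta_{\mathcal G(S)}(Y)$.
   Context: An inverse semigroup is a semigroup $S$ such that for each $s\in S$ there is a unique $s^*\in S$ with $ss^*s=s$ and $s^*ss^*=s^*$. $E(S)$ denotes its set of idempotents. The natural partial order on $S$ is $s\leq t$ if $s=te$ for some $e\in E(S)$. For a finite poset $P$, the zeta function is the $P\times P$ matrix with $\zeta_P(x,y)=1$ if $x\le y$ and $0$ otherwise, and the Möbius function $\mu_P$ is the inverse matrix of $\zeta_P$; $\mu_S$ is the Möbius function of $(S,\leq)$. Conjugacy on $S$ is the smallest equivalence relation $\sim$ on $S$ with $ab\sim ba$ for all $a,b\in S$; the number of conjugacy classes equals the number of isomorphism classes of simple $\mathbb CS$-modules. Representations are over $\mathbb C$, irreducible representations are taken up to equivalence, and the character of a representation $\rho$ is the function $s\mapsto \mathrm{tr}(\rho(s))$. $X=\{x_s\mid s\in S\}$ is a set of variables in bijection with $S$, and polynomials have coefficients in $\mathbb C$. The semigroup determinant $\theta_S=\theta_S(X)$ is the determinant of the $S\times S$ matrix with $(s,t)$-entry $x_{st}$. The groupoid $\mathcal G(S)$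 has object set $E(S)$ and arrow set $S$, where $s$ has domain $\boldsymbol d(s)=s^*s$ and range $\boldsymbol r(s)=ss^*$; composition is the product of $S$ restricted to pairs $(a,b)$ with $\boldsymbol d(a)=\boldsymbol r(b)$. Its determinant $\theta_{\mathcal G(S)}$ is the determinant of the $S\times S$ matrix with $(a,b)$-entry $x_{ab}$ if $\boldsymbol d(a)=\boldsymbol r(b)$ and $0$ otherwise; $\theta_{\mathcal G(S)}(Y)$ is obtained from it by substituting $y_s$ for $x_s$ for all $s\in S$. *)

(* Defs.v *)
From HB Require Import structures.
From mathcomp Require Import all_boot all_order all_algebra.
From mathcomp Require Import mpoly complex reals.

Set Implicit Arguments.
Unset Strict Implicit.
Unset Printing Implicit Defensive.

Import Order.TTheory GRing.Theory Num.Theory.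

Local Open Scope ring_scope.

HB.mixin Record Semigroup_isInverse S of Semigroup S := {
  star : S -> S;
  mul_star_mul : forall s : S, (s * star s * s)%g = s;
  star_mul_star : forall s : S, (star s * s * star s)%g = star s;
  star_unique : forall s t : S,
    (s * t * s)%g = s -> (t * s * t)%g = t -> t = star s
}.

#[short(type="finInverseSemigroupType")]
HB.structure Definition FinInverseSemigroup :=
  {S of Semigroup_isInverse S & Semigroup S & Finite S}.

Section Moebius.
Variables (F : fieldType) (T : finType) (le : rel T).

Definition zeta_mx : 'M[F]_#|T| :=
  \matrix_(i, j) (le (enum_val i) (enum_val j))%:R.

Definition moebius (x y : T) : F :=
  invmx zeta_mx (enum_rank x) (enum_rank y).

End Moebius.

Section InverseSemigroup.
Variable S : finInverseSemigroupType.
Implicit Types s t e a b : S.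

Definition idem : pred S := fun e => (e * e)%g == e.

Definition nle : rel S := fun s t => [exists e, idem e && (s == (t * e)%g)].

Definition dom s : S := (star s * s)%g.
Definition ran s : S := (s * star s)%g.

(* conj_step is symmetric, so its reflexive transitive closure, given by
   connect, is the smallest equivalence relation containing it. *)
Definition conj_step : rel S :=
  fun s t => [exists a, exists b, (s == (a * b)%g) && (t == (b * a)%g)].

Definition conj_classes : {set {set S}} :=
  equivalence_partition (connect conj_step) [set: S].

Section Representations.
Variable F : fieldType.

Definition is_repr n (rho : S -> 'M[F]_n) : Prop :=
  forall s t, rho (s * t)%g = rho s *m rho t.

(* The matrices act on column vectors.  As subspaces are row spaces in the
   library, a subspace of columns is given by the row space of a matrix U
   whose rows are the transposed columns, whence the transpose of rho s.
   The null representation of degree 1 is not irreducible: the corresponding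
   module M satisfies FS M = 0, so it is not simple. *)
Definition irreducible_repr n (rho : S -> 'M[F]_n) : Prop :=
  [/\ is_repr rho,
      exists s, rho s != 0
    & forall U : 'M[F]_n,
        (forall s, stablemx U (rho s)^T) -> U = 0 \/ row_full U].

Definition equiv_repr n m (rho : S -> 'M[F]_n) (sigma : S -> 'M[F]_m) : Prop :=
  exists (A : 'M[F]_(m, n)) (B : 'M[F]_(n, m)),
    [/\ A *m B = 1%:M, B *m A = 1%:M
      & forall s, A *m rho s = sigma s *m A].

(* A list of representatives, without repetition, of the equivalence classes
   of irreducible representations. *)
Definition irr_representatives r (d : 'I_r -> nat)
    (rho : forall i : 'I_r, S -> 'M[F]_(d i)) : Prop :=
  [/\ forall i, irreducible_repr (rho i),
      forall i j, equiv_repr (rho i) (rho j) -> i = j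
    & forall n (sigma : S -> 'M[F]_n),
        irreducible_repr sigma -> exists i, equiv_repr sigma (rho i)].

Definition character n (rho : S -> 'M[F]_n) : S -> F := fun s => \tr (rho s).

End Representations.

Section Determinants.
Variable F : fieldType.
Local Notation poly := {mpoly F[#|S|]}.

Definition var s : poly := 'X_(enum_rank s).

Definition subst (z : S -> poly) (p : poly) : poly :=
  p \mPo [tuple z (enum_val i) | i < #|S|].

Definition theta : poly :=
  \det (\matrix_(i < #|S|, j < #|S|) var (enum_val i * enum_val j)%g).

Definition theta_groupoid : poly :=
  \det (\matrix_(i < #|S|, j < #|S|)
          let a := enum_val i in let b := enum_val j in
          if dom a == ran b then var (a * b)%g else 0).

Definition yvar s : poly := \sum_(t | nle t s) moebius F nle t s *: var t.

(* By Moebius inversion x_s is the sum of the y_t for t <= s; hence the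
   polynomial q = in_yvars p is the expression of p in the variables y_s,
   i.e. p = q(Y). *)
Definition in_yvars (p : poly) : poly :=
  subst (fun s => \sum_(t | nle t s) var t) p.

(* The point with y_e = 1 for e idempotent and y_s = 0 otherwise.  These are
   the coordinates, in the basis of FS given by the arrows of the groupoid, of
   the identity of the algebra FS. *)
Definition idem_point : 'I_#|S| -> F := fun i => (idem (enum_val i))%:R.

(* chi is read off from p: with q = in_yvars p,
     chi(s) = (sum over t <= s of (dq/dy_t)(idem_point)) / q(idem_point),
   a formula which depends on p only up to a nonzero scalar.  If p is a scalar
   multiple of det (sum over t of y_t * rho [t]), with [t] the arrow t as an
   element of FS, then dq/dy_t / q at idem_point is tr (rho [t]); and s is the
   sum of the [t] with t <= s.  For a group and p normalized to have
   coefficient 1 at x_1 ^ d, it is Frobenius' recipe: chi(s) is the coefficient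
   of x_1 ^ (d - 1) * x_s for s <> 1. *)
Definition determines_character (p : poly) (chi : S -> F) : Prop :=
  let q := in_yvars p in
  q.@[idem_point] != 0 /\
  forall s, chi s =
    (\sum_(t | nle t s) (q^`M(enum_rank t)).@[idem_point]) / q.@[idem_point].

End Determinants.
End InverseSemigroup.

Definition irreducible_elt (A : idomainType) (p : A) : Prop :=
  [/\ p != 0, p \isn't a GRing.unit
    & forall a b : A, p = a * b -> a \is a GRing.unit \/ b \is a GRing.unit].

(* Main.v *)
Require Import Defs.
From HB Require Import structures.
From mathcomp Require Import all_boot all_order perm all_algebra.
From mathcomp Require Import mpoly complex reals boolp.

(** Write F for the coefficient field, and for s in S let [s] be the Moebius
transform of s, the sum over t <= s of mu(t, s) t, in the semigroup algebra FS.
The elements [s] form a basis of FS that multiplies like the arrows of the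
groupoid: [a] [b] = [a b] if dom a = ran b, and 0 otherwise.  This rests
on the bijection in [sum_nle_mul].  Everything is therefore done in this basis,
in which s is the sum of the [t] with t <= s.

Change of variables.  The matrix of theta is that of the bilinear form
(a, b) |-> x (a b) on FS, where x is the generic linear form.  In the new basis
it is the groupoid matrix at the values y_s of x on [s], and the base change
is the zeta matrix, of determinant 1 ([theta_subst_groupoid]).

Factorization.  Let g_1, ..., g_r be the irreducible representations, given on
the arrows.  Averaging an arbitrary matrix M over the arrows, as the sum of
h [star s] * M * g [s], yields an intertwiner from g to h, so that Schur's lemma
gives orthogonality of the matrix coefficients ([coef_orthogonal],
[coef_orthogonal_self]); hence these are linearly independent functions on S.
They also span: otherwise the elements of FS killed by all g_i contain a minimal
left ideal U, which as a representation is one of the g_i, so that U U = 0, and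
averaging a projection onto U contradicts this ([no_killed_left_ideal]).  So the
coefficients form an invertible matrix, and it transforms the groupoid matrix
into a block diagonal matrix, where the generic matrix Q_i, the sum of
y_s * g_i [s], occurs d_i times ([groupoid_mx_coef]).  Thus
theta_groupoid is a nonzero scalar times the product of the det (Q_i) ^ d_i, and
the scalar is absorbed by one of the factors.

Number of factors.  The functions constant on the conjugacy classes are the f
with f (a b) = f (b a).  By orthogonality and Schur's lemma the irreducible
characters form a basis of this space ([family_char_free], [family_char_span]),
hence r is the number of classes.

Irreducibility.  Since the coefficients form an invertible matrix, the entries
of the Q_i are, up to a linear change of variables, distinct variables.  A
determinant of distinct variables has degree 1 in the variables of each row and
of each column, so each row and each column goes to exactly one of the two
factors in a factorization; all of them must go to the same one, because the
variable where a row and a column meet does occur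
([det_var_mx_irreducible]).

Characters.  At the point where y_e = 1 for e idempotent and the other y_s
vanish, Q_i is the identity matrix, and there the derivative of det is the trace
of the derivative, so that the derivative with respect to y_t is the trace of
g_i [t] ([repr_factor_character]).  As the factors determine the pairwise
distinct characters, no two of them are proportional. *)

Set Implicit Arguments.
Unset Strict Implicit.
Unset Printing Implicit Defensive.

Import GRing.Theory.
Local Open Scope ring_scope.

(** * Moebius inversion on a finite poset *)

Section FinitePoset.
Variables (T : finType) (le : rel T).
Hypotheses (le_refl : reflexive le) (le_anti : antisymmetric le).
Hypothesis le_trans : transitive le.

Let down_proper s t : le s t -> s != t ->
  [set u | le u s] \proper [set u | le u t].
Proof.
move=> st sNt; apply/properP; split.
  by apply/subsetP => u; rewrite !inE => /le_trans -> //.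
exists t; rewrite !inE ?le_refl //; apply/negP => ts.
by move/negP: sNt; apply; apply/eqP/le_anti; rewrite st ts.
Qed.

(** Induction along the strict order, which is well founded as down-sets grow. *)
Lemma poset_ind (P : T -> Prop) :
  (forall t, (forall s, le s t -> s != t -> P s) -> P t) -> forall t, P t.
Proof.
move=> IH t; have [n] := ubnP #|[set u | le u t]|.
elim: n => // n IHn in t *; rewrite ltnS => tn; apply: IH => s st sNt.
exact/IHn/(leq_trans _ tn)/proper_card/down_proper.
Qed.

(** Injectivity of the summation over down-sets; it replaces Moebius inversion
    whenever no explicit inverse is needed. *)
Lemma sum_down_inj (V : zmodType) (g h : T -> V) :
  (forall t, \sum_(s | le s t) g s = \sum_(s | le s t) h s) -> g =1 h.
Proof.
move=> gh; elim/poset_ind => t IH; move: (gh t).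
rewrite [LHS](bigD1 t) ?le_refl //= [RHS](bigD1 t) ?le_refl //=.
by rewrite [X in _ + X = _](eq_bigr h) => [/addIr //|s /andP[]]; apply: IH.
Qed.

Section Field.
Variable F : fieldType.

(** A permutation contributing to the determinant moves every point upwards, so it
    enlarges every down-set; the total size of the down-sets being preserved, it
    must be the identity. *)
Lemma det_zeta_mx : \det (zeta_mx F le) = 1.
Proof.
rewrite /determinant (bigD1 (1%g : 'S_#|T|)) //= [X in _ + X]big1 => [|s sN1].
  rewrite odd_perm1 mul1r addr0 big1 // => i _.
  by rewrite !mxE perm1 le_refl.
have [/forallP sle|] := boolP [forall i, le (enum_val i) (enum_val (s i))].
  case/negP: sN1; apply/eqP/permP => i; rewrite perm1.
  pose h (i : 'I_#|T|) := #|[set u | le u (enum_val i)]|.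
  have hle j : (h j <= h (s j))%N.
    by apply/subset_leq_card/subsetP => u; rewrite !inE => /le_trans->.
  have hs : (\sum_j h j = \sum_j h (s j))%N by apply: reindex_inj; exact: perm_inj.
  have {}hs : h i = h (s i).
    move: hs; rewrite (bigD1 i) //= [in RHS](bigD1 i) //= => hs.
    apply/eqP; rewrite eqn_leq hle /= -(leq_add2r (\sum_(j | j != i) h j)%N) hs.
    by rewrite leq_add2l; apply: leq_sum => j _; apply: hle.
  apply/eqP; apply: contraT; rewrite eq_sym => iNs.
  have := proper_card (down_proper (sle i) _).
  by rewrite (inj_eq enum_val_inj) => /(_ iNs); rewrite -/(h _) hs ltnn.
rewrite negb_forall => /existsP[i /negbTE ile].
by rewrite (bigD1 i) //= mxE ile mul0r mulr0.
Qed.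

Local Notation mu := (moebius F le).

Lemma moebius_sumr s t : \sum_(u | le u t) mu s u = (s == t)%:R.
Proof.
have Z : zeta_mx F le \in unitmx by rewrite unitmxE det_zeta_mx unitr1.
have := mulVmx Z => /matrixP/(_ (enum_rank s) (enum_rank t)).
rewrite !mxE (inj_eq enum_rank_inj) => <-.
rewrite (reindex_onto enum_rank enum_val) => [|i _]; last exact: enum_valK.
rewrite [RHS]big_mkcond /= big_mkcond; apply: eq_bigr => u _.
by rewrite !mxE !enum_rankK eqxx; case: le; rewrite ?mulr1 ?mulr0.
Qed.

(** The inverse matrix is triangular too: the sum of mu(s, u) over u <= t vanishes
    for s <> t, and all its terms but the one for t vanish by induction. *)
Lemma moebius_nle s t : ~~ le s t -> mu s t = 0.
Proof.
elim/poset_ind: t => t IH Nst; have := moebius_sumr s t.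
have /negbTE-> : s != t by apply: contra Nst => /eqP->.
rewrite (bigD1 t) ?le_refl //= big1 ?addr0 // => u /andP[ut uNt].
by apply: IH => //; apply: contra Nst => /le_trans->.
Qed.

Lemma moebius_inversion (V : lmodType F) (g : T -> V) t :
  \sum_(s | le s t) \sum_(u | le u s) mu u s *: g u = g t.
Proof.
transitivity (\sum_(s | le s t) \sum_u mu u s *: g u).
  apply: eq_bigr => s _; rewrite big_mkcond; apply: eq_bigr => u _.
  by case: ifPn => // /moebius_nle->; rewrite scale0r.
rewrite exchange_big (bigD1 t) //= -scaler_suml moebius_sumr eqxx scale1r.
rewrite big1 ?addr0 // => u uNt.
by rewrite -scaler_suml moebius_sumr (negbTE uNt) scale0r.
Qed.

End Field.
End FinitePoset.

(** * Inverse semigroups and the groupoid of their arrows *)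

Section InverseSemigroupTheory.
Variable S : finInverseSemigroupType.
Implicit Types s t u v e f a b : S.
Local Open Scope group_scope.

Lemma idemP e : reflect (e * e = e) (idem e).
Proof. exact: eqP. Qed.

Lemma star_idem e : idem e -> star e = e.
Proof. by move/idemP => ee; rewrite -(@star_unique _ e e) // !ee. Qed.

Lemma starK : involutive (@star S).
Proof.
by move=> s; rewrite -(@star_unique _ (star s) s) // (mul_star_mul, star_mul_star).
Qed.

(** The classical argument: the inverse of a product of idempotents is idempotent,
    hence so is the product; then e f and f e are inverse to each other, and an
    idempotent is its own inverse. *)
Lemma idem_mulC e f : idem e -> idem f -> e * f = f * e.
Proof.
have idemM a b : idem a -> idem b -> idem (a * b).
  move=> /idemP aa /idemP bb; set x := star (a * b).
  have xabx : x * (a * b) * x = x by apply: star_mul_star.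
  have xE : x = b * x * a.
    apply/esym/star_unique.
      rewrite -[RHS](mul_star_mul (a * b)) -/x !mulgA.
      by rewrite -[a * b * b]mulgA bb -[_ * a * a]mulgA aa.
    rewrite -[in RHS]xabx !mulgA.
    by rewrite -[b * x * a * a]mulgA aa -[_ * b * b]mulgA bb.
  have xx : idem x.
    apply/idemP; transitivity (b * (x * (a * b) * x) * a).
      by rewrite {1 2}xE !mulgA.
    by rewrite xabx -xE.
  by rewrite -[a * b]starK -/x star_idem.
move=> ide idf; have [/idemP ee /idemP ff] := (ide, idf).
rewrite -(star_idem (idemM _ _ ide idf)); apply/esym/star_unique.
  by rewrite !mulgA -[e * f * f]mulgA ff -[_ * e * e]mulgA ee -mulgA;
     apply/idemP/idemM.
by rewrite !mulgA -[f * e * e]mulgA ee -[_ * f * f]mulgA ff -mulgA;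
   apply/idemP/idemM.
Qed.

Lemma idem_mul e f : idem e -> idem f -> idem (e * f).
Proof.
move=> ide idf; apply/idemP.
rewrite mulgA -[e * f * e]mulgA -(idem_mulC ide idf) mulgA.
by move/idemP: ide ->; rewrite -mulgA; move/idemP: idf ->.
Qed.

Lemma idem_dom s : idem (dom s).
Proof. by apply/idemP; rewrite /dom mulgA star_mul_star. Qed.

Lemma idem_ran s : idem (ran s).
Proof. by apply/idemP; rewrite /ran mulgA mul_star_mul. Qed.

Lemma mul_dom s : s * dom s = s.
Proof. by rewrite /dom mulgA mul_star_mul. Qed.

Lemma ran_mul s : ran s * s = s.
Proof. exact: mul_star_mul. Qed.

Lemma starM s t : star (s * t) = star t * star s.
Proof.
have C := idem_mulC (idem_ran t) (idem_dom s).
apply/esym/star_unique.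
  transitivity (s * (ran t * dom s) * t); first by rewrite /dom /ran !mulgA.
  by rewrite C mulgA mul_dom -mulgA ran_mul.
transitivity (star t * (dom s * ran t) * star s); first by rewrite /dom /ran !mulgA.
by rewrite -C /dom /ran !mulgA star_mul_star -!mulgA [star s * _]mulgA star_mul_star.
Qed.

Lemma dom_star s : dom (star s) = ran s.
Proof. by rewrite /dom starK. Qed.

Lemma ran_star s : ran (star s) = dom s.
Proof. by rewrite /ran starK. Qed.

Lemma dom_idem e : idem e -> dom e = e.
Proof. by move=> ide; rewrite /dom star_idem //; apply/idemP. Qed.

Lemma ran_idem e : idem e -> ran e = e.
Proof. by move=> ide; rewrite /ran star_idem //; apply/idemP. Qed.

Lemma dom_mul s t : dom s = ran t -> dom (s * t) = dom t.
Proof.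
move=> st; rewrite {1}/dom starM mulgA -[_ * _ * s]mulgA -/(dom s) st.
by rewrite -mulgA ran_mul.
Qed.

Lemma ran_mulr s t : dom s = ran t -> ran (s * t) = ran s.
Proof.
move=> st; rewrite {1}/ran starM mulgA -[s * t * _]mulgA -/(ran t) -st.
by rewrite mul_dom.
Qed.

Lemma dom_mulr_idem s e : idem e -> dom (s * e) = dom s * e.
Proof.
move=> ide; rewrite /dom starM (star_idem ide) !mulgA -[e * _ * s]mulgA -/(dom s).
rewrite (idem_mulC ide (idem_dom s)) -mulgA.
by congr (_ * _); apply/idemP.
Qed.

Lemma mul_starK s a : dom s = ran a -> s * a * star a = s.
Proof. by move=> sa; rewrite -mulgA -/(ran a) -sa mul_dom. Qed.

Lemma mul_star_mulr s a : dom s = ran a -> a * star (s * a) = star s.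
Proof.
by move=> sa; rewrite starM mulgA -/(ran a) -sa -ran_star ran_mul.
Qed.

(** Together with [mul_starK] this identifies the arrows v with dom v = ran a with
    the arrows v * a, for [reindex_mul]. *)
Lemma dom_mul_inj s a : dom (s * a) = dom a -> s * a * star a = s -> dom s = ran a.
Proof.
move=> da sa; rewrite -{1}sa.
have -> : dom (s * a * star a) = a * dom (s * a) * star a.
  by rewrite /dom !starM starK !mulgA.
by rewrite da mul_dom.
Qed.

Lemma ran_star_mul s a : ran (star a * s) = dom (star s * a).
Proof. by rewrite /ran /dom !starM !starK. Qed.

Lemma mul_mul_star s a : ran s = ran a -> a * (star a * s) = s.
Proof. by move=> sa; rewrite mulgA -/(ran a) -sa ran_mul. Qed.

Lemma ran_mul_inj s a : ran (star a * s) = dom a -> a * (star a * s) = s -> ran s = ran a.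
Proof.
rewrite ran_star_mul -dom_star => da sa; apply: dom_mul_inj => //.
by rewrite -[in RHS]sa !starM starK.
Qed.

(** Left translation by star a is a bijection of the groupoid arrows ending at
    ran a onto those ending at dom a. *)
Lemma reindex_mul_star (V : nmodType) a (f : S -> V) :
  (\sum_(s | ran s == dom a) f s = \sum_(v | ran v == ran a) f (star a * v)%g)%R.
Proof.
rewrite (reindex_onto (fun v => star a * v) (fun s => a * s)) /= => [|s /eqP sa].
  apply: eq_bigl => v; apply/andP/eqP => [[/eqP ra /eqP]|va]; first exact: ran_mul_inj.
  by rewrite mul_mul_star // ran_mulr ?ran_star ?dom_star ?va // !eqxx.
by rewrite mulgA -/(dom a) -sa ran_mul.
Qed.

(** Right translation by a is a bijection of the groupoid arrows starting at ran a
    onto those starting at dom a. *)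
Lemma reindex_mul (V : nmodType) a (f : S -> V) :
  (\sum_(s | dom s == dom a) f s = \sum_(v | dom v == ran a) f (v * a)%g)%R.
Proof.
rewrite (reindex_onto (fun v => v * a) (fun s => s * star a)) /= => [|s /eqP sa].
  apply: eq_bigl => v; apply/andP/eqP => [[/eqP da /eqP]|va]; first exact: dom_mul_inj.
  by rewrite dom_mul // mul_starK // !eqxx.
by rewrite -mulgA -/(dom a) -sa mul_dom.
Qed.

Lemma nleP s t : reflect (s = t * dom s) (nle s t).
Proof.
apply: (iffP existsP) => [[e /andP[ide /eqP->]]|st]; last first.
  by exists (dom s); rewrite idem_dom -st eqxx.
by rewrite dom_mulr_idem // mulgA mul_dom.
Qed.

Lemma nle_refl : reflexive (@nle S).
Proof. by move=> s; apply/nleP; rewrite mul_dom. Qed.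

Lemma nle_mulr e s : idem e -> nle (s * e) s.
Proof. by move=> ide; apply/existsP; exists e; rewrite ide /=. Qed.

Lemma nle_trans : transitive (@nle S).
Proof.
move=> t s u /existsP[e /andP[ide /eqP->]] /existsP[f /andP[idf /eqP->]].
by rewrite -mulgA nle_mulr ?idem_mul.
Qed.

Lemma nle_anti : antisymmetric (@nle S).
Proof.
move=> s t /andP[/nleP st /nleP ts].
rewrite {1}st {1}ts -mulgA (idem_mulC (idem_dom t) (idem_dom s)) mulgA mul_dom.
by rewrite -ts.
Qed.

Lemma nle_mul s t u v : nle u s -> nle v t -> dom u = ran v -> nle (u * v) (s * t).
Proof.
move=> /nleP us /nleP vt uv; apply/nleP; rewrite dom_mul //.
by rewrite {1}us uv -mulgA ran_mul -mulgA -vt.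
Qed.

(** Here ran x commutes with dom s, which brings dom s next to x in x * dom (s x). *)
Lemma dom_mul_id s x : x * dom (s * x) = x -> dom s * x = x.
Proof.
move=> xE; rewrite -[RHS]xE.
have -> : dom (s * x) = star x * dom s * x by rewrite /dom starM !mulgA.
rewrite 2!(mulgA x) -/(ran x) (idem_mulC (idem_ran x) (idem_dom s)).
by rewrite -(mulgA _ (ran x) x) ran_mul.
Qed.

(** The converse of [nle_mul]: below a product, w splits in a composable way, the
    right factor x being the restriction of t to the domain of w. *)
Lemma nle_mul_factor s t w (x := t * dom w) : nle w (s * t) ->
  s * ran x * x = w /\ dom (s * ran x) = ran x.
Proof.
move=> /nleP; rewrite -mulgA -/x => wE.
have sx : dom s * x = x.
  by apply: dom_mul_id; rewrite -wE /x -mulgA; congr (_ * _); apply/idemP/idem_dom.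
split; first by rewrite -mulgA ran_mul -wE.
by rewrite dom_mulr_idem ?idem_ran // /ran mulgA sx.
Qed.

(** The composable pairs (a, b) with a <= s and b <= t are in bijection with the
    w <= s t, through composition.  This single identity shows that the Moebius
    transform turns the product of S into the composition of the groupoid. *)
Lemma sum_nle_mul (V : nmodType) s t (f : S -> V) :
  (\sum_(a | nle a s) \sum_(b | nle b t)
     (if dom a == ran b then f (a * b)%g else 0)
   = \sum_(w | nle w (s * t)%g) f w)%R.
Proof.
transitivity (\sum_(a | nle a s) \sum_(b | nle b t && (dom a == ran b))
                 f (a * b)%g)%R.
  by apply: eq_bigr => a _; rewrite -big_mkcondr.
rewrite pair_big_dep /=.
rewrite (reindex_onto (fun w => (s * ran (t * dom w), t * dom w))
                      (fun p => p.1 * p.2)) /=; last first.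
  move=> [a b] /= /and3P[/nleP sa /nleP tb /eqP ab].
  by rewrite dom_mul // -tb -ab -sa.
apply: eq_big => [w|w /andP[_ /eqP->] //].
apply/andP/idP => [[/and3P[ws wt /eqP dr] /eqP<-]|wst]; first exact: nle_mul.
have [-> dr] := nle_mul_factor wst.
by rewrite !nle_mulr ?idem_ran ?idem_dom ?dr ?eqxx.
Qed.

End InverseSemigroupTheory.

(** * Representations of the semigroup and of its groupoid *)

Section GroupoidRepresentations.
Variables (S : finInverseSemigroupType) (F : fieldType).
Implicit Types s t a b : S.

Definition nle_sum (V : nmodType) (g : S -> V) s : V := \sum_(t | nle t s) g t.

(** If g is a representation of S, extended linearly to FS, this is its value on the
    arrow s; [nle_sum] goes back. *)
Definition nle_moebius (V : lmodType F) (g : S -> V) s : V :=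
  \sum_(t | nle t s) moebius F (@nle S) t s *: g t.

Lemma nle_moebiusK (V : lmodType F) (g : S -> V) :
  nle_sum (nle_moebius g) =1 g.
Proof.
exact/moebius_inversion/nle_trans/nle_anti/nle_refl.
Qed.

Lemma nle_sum_inj (V : zmodType) (g h : S -> V) :
  nle_sum g =1 nle_sum h -> g =1 h.
Proof. by move=> gh; apply: (sum_down_inj (@nle_refl S) (@nle_anti S) (@nle_trans S)). Qed.

(** Two-variable version, by which identities on products of arrows are read off
    from identities on products in S. *)
Lemma nle_sum2_inj (V : zmodType) (g h : S -> S -> V) :
  (forall s t, nle_sum (fun a => nle_sum (g a) t) s
             = nle_sum (fun a => nle_sum (h a) t) s) ->
  forall a b, g a b = h a b.
Proof.
move=> gh a; apply: nle_sum_inj => t; move: a.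
by apply: nle_sum_inj => s; apply: gh.
Qed.

(** Representations of the groupoid algebra. *)
Definition groupoid_repr n (g : S -> 'M[F]_n) : Prop :=
  forall a b, g a *m g b = if dom a == ran b then g (a * b)%g else 0.

(** The same conditions as for [irreducible_repr], stated on the arrows. *)
Definition groupoid_irr n (g : S -> 'M[F]_n) : Prop :=
  [/\ groupoid_repr g,
      exists s, g s != 0
    & forall U : 'M[F]_n,
        (forall s, stablemx U (g s)^T) -> U = 0 \/ row_full U].

Lemma nle_sum_repr n (g : S -> 'M[F]_n) :
  groupoid_repr g -> is_repr (nle_sum g).
Proof.
move=> gP s t; rewrite /nle_sum mulmx_suml -sum_nle_mul.
apply: eq_bigr => a _; rewrite mulmx_sumr.
by apply: eq_bigr => b _; rewrite gP.
Qed.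

(** Summed over all a <= s and b <= t both sides give rho (s t), by [sum_nle_mul]. *)
Lemma nle_moebius_repr n (rho : S -> 'M[F]_n) :
  is_repr rho -> groupoid_repr (nle_moebius rho).
Proof.
move=> rhoP; set g := nle_moebius rho => a b; move: a b.
apply: nle_sum2_inj => s t; rewrite /nle_sum sum_nle_mul.
rewrite -/(nle_sum g (s * t)%g) nle_moebiusK rhoP -!(nle_moebiusK rho) /nle_sum.
rewrite mulmx_suml; apply: eq_bigr => a _; rewrite mulmx_sumr.
exact: eq_bigr.
Qed.

Lemma stablemx_nle_moebius n (rho : S -> 'M[F]_n) (U : 'M[F]_n) :
  (forall s, stablemx U (rho s)^T) <->
  (forall s, stablemx U (nle_moebius rho s)^T).
Proof.
split=> st s.
  rewrite /nle_moebius raddf_sum /= mulmx_sumr summx_sub // => t _.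
  by rewrite linearZ /= -scalemxAr; apply/scalemx_sub/st.
rewrite -(nle_moebiusK rho) /nle_sum raddf_sum /= mulmx_sumr.
by rewrite summx_sub // => t _; apply: st.
Qed.

Lemma exists_nle_sum_neq0 (V : zmodType) (g : S -> V) :
  (exists s, g s != 0) <-> (exists s, nle_sum g s != 0).
Proof.
split=> [[s gs]|[s]].
  have /existsP // : [exists s, nle_sum g s != 0].
  apply: contraR gs; rewrite negb_exists => /forallP g0.
  apply/eqP; move: s; apply: nle_sum_inj => s.
  by rewrite [RHS]big1 //; apply/eqP; rewrite -[_ == _]negbK.
have [/existsP //|] := boolP [exists s, g s != 0].
rewrite negb_exists => /forallP g0; rewrite /nle_sum big1 ?eqxx // => t _.
by apply/eqP; rewrite -[_ == _]negbK.
Qed.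

Lemma irreducible_moebius n (rho : S -> 'M[F]_n) :
  irreducible_repr rho -> groupoid_irr (nle_moebius rho).
Proof.
case=> rhoP [s rs] irr; split; first exact: nle_moebius_repr.
  by apply/exists_nle_sum_neq0; exists s; rewrite nle_moebiusK.
by move=> U st; apply/irr/stablemx_nle_moebius.
Qed.

Lemma moebius_nle_sum (V : lmodType F) (g : S -> V) :
  nle_moebius (nle_sum g) =1 g.
Proof. by apply: nle_sum_inj => s; apply: nle_moebiusK. Qed.

Lemma groupoid_irr_sum n (g : S -> 'M[F]_n) :
  groupoid_irr g -> irreducible_repr (nle_sum g).
Proof.
case=> gP nz irr; split; [exact: nle_sum_repr|exact: (exists_nle_sum_neq0 g).1|].
move=> U /stablemx_nle_moebius st; apply: irr => s.
by have := st s; rewrite moebius_nle_sum.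
Qed.

Lemma equiv_nle_sum n m (g : S -> 'M[F]_n) (h : S -> 'M[F]_m) :
  equiv_repr (nle_sum g) (nle_sum h) <-> equiv_repr g h.
Proof.
split=> -[A [B [AB BA eq]]]; exists A, B; split=> // s.
  move: s; apply: nle_sum_inj => s; have := eq s.
  by rewrite /nle_sum mulmx_suml mulmx_sumr.
rewrite /nle_sum mulmx_suml mulmx_sumr; exact: eq_bigr.
Qed.

Section OneRepresentation.
Variables (n : nat) (g : S -> 'M[F]_n).
Hypothesis gP : groupoid_repr g.

(** The image of the identity of FS, which is the sum of the idempotent arrows. *)
Definition repr_unit : 'M[F]_n := \sum_(e | idem e) g e.

Lemma mul_repr_unit s : repr_unit *m g s = g s.
Proof.
rewrite mulmx_suml (bigD1 (ran s)) ?idem_ran //= gP dom_idem ?idem_ran // eqxx.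
rewrite ran_mul big1 ?addr0 // => e /andP[ide /negbTE eNs].
by rewrite gP dom_idem // eNs.
Qed.

Lemma mulr_repr_unit s : g s *m repr_unit = g s.
Proof.
rewrite mulmx_sumr (bigD1 (dom s)) ?idem_dom //= gP ran_idem ?idem_dom // eqxx.
rewrite mul_dom big1 ?addr0 // => e /andP[ide eNs].
by rewrite gP ran_idem // eq_sym (negbTE eNs).
Qed.

Hypothesis charF : [pchar F] =i pred0.

(** Multiplied by g t on the left, the sum of the g (dom s) becomes g t times the
    number of arrows with the same domain as t, which is not zero in F. *)
Lemma sum_dom_mul_eq0 m (X : 'M[F]_(n, m)) t :
  (\sum_s g (dom s)) *m X = 0 -> g t *m X = 0.
Proof.
move=> /(congr1 (mulmx (g t))); rewrite mulmx0 mulmxA mulmx_sumr.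
rewrite (bigID (fun s => dom s == dom t)) /= [X in _ + X]big1 ?addr0; last first.
  by move=> s sNt; rewrite gP ran_idem ?idem_dom // eq_sym (negbTE sNt).
rewrite (eq_bigr (fun=> g t)) => [|s /eqP st]; last first.
  by rewrite gP ran_idem ?idem_dom // st eqxx mul_dom.
rewrite sumr_const -scaler_nat -scalemxAl => /eqP.
rewrite scaler_eq0 => /orP[|/eqP //].
rewrite ((pcharf0P F).1 charF).
move=> /eqP/card0_eq/(_ t).
by rewrite unfold_in -[X in X = _]/(dom t == dom t) eqxx.
Qed.

End OneRepresentation.

(** The image of the identity of FS is an idempotent commuting with everything, so
    its image is a submodule; it is not 0 because some g s is not. *)
Lemma irr_repr_unit n (g : S -> 'M[F]_n) : groupoid_irr g -> repr_unit g = 1%:M.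
Proof.
case=> gP [s gs] irr; set E := repr_unit g.
have EE : E *m E = E.
  by rewrite {2}/E mulmx_sumr; apply: eq_bigr => e _; rewrite mul_repr_unit.
have st a : stablemx E^T (g a)^T.
  by rewrite -trmx_mul mulr_repr_unit // -[in X in (X <= _)%MS](mul_repr_unit gP)
             trmx_mul submxMl.
case: (irr _ st) => [/(congr1 trmx)|/row_fullP[B BE]].
  rewrite trmxK trmx0 => E0.
  by case/eqP: gs; rewrite -(mul_repr_unit gP) -/E E0 mul0mx.
have EB : E *m B^T = 1%:M by rewrite -[E]trmxK -trmx_mul BE trmx1.
by rewrite -EB -{2}EE -mulmxA EB mulmx1.
Qed.

(** The analogue, for the groupoid, of averaging over a finite group. *)
Definition average n m (h : S -> 'M[F]_m) (M : 'M[F]_(m, n)) (g : S -> 'M[F]_n) :=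
  \sum_s h (star s) *m M *m g s.

(** Moving the arrow a from the left to the right amounts to the translation s = u a
    of the summation index. *)
Lemma average_intertwines n m (g : S -> 'M[F]_n) (h : S -> 'M[F]_m) M a :
  groupoid_repr g -> groupoid_repr h ->
  h a *m average h M g = average h M g *m g a.
Proof.
move=> gP hP; rewrite mulmx_sumr mulmx_suml.
rewrite (bigID (fun s => dom s == dom a)) /= [X in _ + X]big1 ?addr0; last first.
  by move=> s sNa; rewrite !mulmxA hP ran_star eq_sym (negbTE sNa) !mul0mx.
rewrite [RHS](bigID (fun u => dom u == ran a)) /= [X in _ = _ + X]big1 ?addr0;
  last by move=> u uNa; rewrite -mulmxA gP (negbTE uNa) mulmx0.
rewrite reindex_mul; apply: eq_bigr => u /eqP ua.
by rewrite !mulmxA hP ran_star dom_mul // eqxx mul_star_mulr // -[RHS]mulmxA gP ua eqxx.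
Qed.

End GroupoidRepresentations.

(** * Schur's lemma and orthogonality *)

Section Schur.
Variable S : finInverseSemigroupType.
Implicit Types s t : S.

Section AnyField.
Variable F : fieldType.

Lemma irr_dim_gt0 n (g : S -> 'M[F]_n) : groupoid_irr g -> (0 < n)%N.
Proof. by case: n g => // g [_ [s /eqP[]]]; apply/matrixP => -[]. Qed.

(** The image and the kernel of an intertwiner are submodules; they appear as the
    row space and the row kernel of the transpose, since columns are acted upon. *)
Lemma schur_inverse n m (g : S -> 'M[F]_n) (h : S -> 'M[F]_m) (C : 'M[F]_(m, n)) :
  groupoid_irr g -> groupoid_irr h -> (forall s, h s *m C = C *m g s) -> C != 0 ->
  exists2 B, C *m B = 1%:M & B *m C = 1%:M.
Proof.
move=> [_ _ girr] [_ _ hirr] hC C0.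
have st1 s : stablemx <<C^T>>%MS (h s)^T.
  by rewrite (eqmxMr _ (genmxE _)) genmxE -trmx_mul hC trmx_mul submxMl.
have st2 s : stablemx (kermx C^T) (g s)^T.
  by rewrite sub_kermx -mulmxA -trmx_mul -hC trmx_mul mulmxA mulmx_ker mul0mx.
case: (hirr _ st1) => [/eqP|]; first by rewrite (eqmx_eq0 (genmxE _)) trmx_eq0 (negbTE C0).
rewrite /row_full genmxE => /row_fullP[B BC].
case: (girr _ st2) => [/eqP|]; last first.
  rewrite -sub1mx sub_kermx mul1mx trmx_eq0; by move/negP: C0.
rewrite kermx_eq0 => /row_freeP[B' CB'].
have {}BC : C *m B^T = 1%:M by rewrite -[C]trmxK -trmx_mul BC trmx1.
have {}CB' : B'^T *m C = 1%:M by rewrite -[C]trmxK -trmx_mul CB' trmx1.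
exists B^T => //; rewrite -[B^T]mul1mx -CB' -mulmxA -mulmxA (mulmxA C) BC.
by rewrite mul1mx.
Qed.

Lemma average_inequiv n m (g : S -> 'M[F]_n) (h : S -> 'M[F]_m) M :
  groupoid_irr g -> groupoid_irr h -> ~ equiv_repr g h -> average h M g = 0.
Proof.
move=> gI hI gNh; have [gP _ _] := gI; have [hP _ _] := hI.
apply/eqP; apply: contraT => A0.
have [|B AB BA] := schur_inverse gI hI _ A0.
  by move=> s; apply: average_intertwines.
by case: gNh; exists (average h M g), B; split=> // s; rewrite average_intertwines.
Qed.

(** Averaging matrix units produces the pairings of single coefficients. *)
Lemma average_delta n m (g : S -> 'M[F]_n) (h : S -> 'M[F]_m) a b c d :
  average h (delta_mx b c) g a d = \sum_s h (star s) a b * g s c d.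
Proof.
rewrite summxE; apply: eq_bigr => s _.
rewrite mxE (bigD1 c) //= big1 ?addr0 => [|i iNc].
  congr (_ * _); rewrite mxE (bigD1 b) //= mxE !eqxx mulr1 big1 ?addr0 // => i iNb.
  by rewrite mxE (negbTE iNb) mulr0.
by rewrite mxE big1 ?mul0r // => j _; rewrite mxE (negbTE iNc) andbF mulr0.
Qed.

Lemma coef_orthogonal n m (g : S -> 'M[F]_n) (h : S -> 'M[F]_m) a b c d :
  groupoid_irr g -> groupoid_irr h -> ~ equiv_repr g h ->
  \sum_s h (star s) a b * g s c d = 0.
Proof. by move=> gI hI gNh; rewrite -average_delta average_inequiv ?mxE. Qed.

End AnyField.

Variable F : closedFieldType.
Hypothesis charF : [pchar F] =i pred0.

Lemma schur_scalar n (g : S -> 'M[F]_n) (C : 'M[F]_n) :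
  groupoid_irr g -> (forall s, g s *m C = C *m g s) -> exists x, C = x%:M.
Proof.
move=> gI gC; have [gP [s gs] _] := gI.
have [x] : exists x, root (char_poly C) x.
  apply/closed_rootP; rewrite size_char_poly.
  by have := irr_dim_gt0 gI; case: (n).
rewrite -eigenvalue_root_char => /eqP xC; exists x.
apply/eqP; rewrite -subr_eq0; apply: contraT => Cx.
have [|B CB _] := schur_inverse gI gI _ Cx.
  by move=> t; rewrite mulmxBr mulmxBl gC scalar_mxC.
case: xC; apply/eqP; rewrite kermx_eq0; apply/row_freeP; by exists B.
Qed.

(** By Schur's lemma the average of the matrix unit at (b, c) is a scalar matrix, so
    the sum is x b c if a = d, and 0 otherwise.  Exchanging s and star s swaps
    the pairs (a, d) and (c, b), which forces x b c to be a constant times the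
    Kronecker symbol.  The constant is not 0: otherwise the average of the identity
    matrix would vanish, which is the sum of the g (dom s). *)
Lemma coef_orthogonal_self n (g : S -> 'M[F]_n) : groupoid_irr g ->
  exists2 x, x != 0 &
    forall a b c d, \sum_s g (star s) a b * g s c d = x * ((a == d) && (b == c))%:R.
Proof.
move=> gI; have [gP [s0 gs0] _] := gI.
have i0 := Ordinal (irr_dim_gt0 gI).
pose x b c := average g (delta_mx b c) g i0 i0.
have Ex a b c d : \sum_s g (star s) a b * g s c d = x b c * (a == d)%:R.
  rewrite -average_delta /x.
  have [|y ->] := @schur_scalar n g (average g (delta_mx b c) g) gI.
    by move=> s; apply: average_intertwines.
  by rewrite !mxE eqxx mulr_natr.
have sym a b c d : x b c * (a == d)%:R = x d a * (c == b)%:R.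
  rewrite -!Ex (reindex_inj (inv_inj (@starK S))) /=.
  by apply: eq_bigr => s _; rewrite starK mulrC.
exists (x i0 i0) => [|a b c d]; last first.
  rewrite Ex; have := sym i0 b c i0; rewrite eqxx mulr1 => ->.
  by rewrite -mulrA -natrM mulnb andbC eq_sym [c == b]eq_sym [d == a]eq_sym.
apply: contra gs0 => /eqP x0.
have {x0}x0 b c : x b c = 0 by have := sym i0 b c i0; rewrite eqxx mulr1 x0 mul0r.
rewrite -[g s0]mulmx1; apply/eqP/sum_dom_mul_eq0 => //; rewrite mulmx1.
transitivity (\sum_s g (star s) *m g s).
  by apply: eq_bigr => s _; rewrite gP dom_star eqxx.
apply/matrixP => a d; rewrite summxE mxE.
under eq_bigr do rewrite mxE.
by rewrite exchange_big big1 //= => k _; rewrite Ex x0 mul0r.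
Qed.

End Schur.

(** * Completeness: the irreducible representations separate the semigroup algebra *)

Section Completeness.
Variables (S : finInverseSemigroupType) (F : fieldType).
Implicit Types s t : S.
Hypothesis charF : [pchar F] =i pred0.
Local Notation n := #|S|.

(** Left multiplication by the arrow s in the basis of arrows, acting on columns; on
    rows it acts through the transpose. *)
Definition regular_mx s : 'M[F]_n :=
  \matrix_(i, j) ((dom s == ran (enum_val j)) && (enum_val i == s * enum_val j)%g)%:R.

Definition arrow_row s : 'rV[F]_n := delta_mx 0 (enum_rank s).

Lemma arrow_row_regular s t : arrow_row t *m (regular_mx s)^T =
  if dom s == ran t then arrow_row (s * t)%g else 0.
Proof.
apply/rowP => i; rewrite -rowE !mxE enum_rankK.
case: ifP => _; rewrite !mxE // eqxx /=.
by rewrite -(inj_eq enum_rank_inj) enum_valK.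
Qed.

Lemma row_sum_arrow (v : 'rV[F]_n) : v = \sum_s v 0 (enum_rank s) *: arrow_row s.
Proof.
rewrite {1}[v]row_sum_delta (reindex_onto enum_rank enum_val) => [|i _]; last exact: enum_valK.
by apply: eq_bigl => s; rewrite enum_rankK eqxx.
Qed.

Lemma row_arrow_ext m (A B : 'M[F]_(n, m)) :
  (forall s, arrow_row s *m A = arrow_row s *m B) -> A = B.
Proof.
move=> AB; apply/row_matrixP => i; rewrite !rowE.
by have := AB (enum_val i); rewrite /arrow_row enum_valK.
Qed.

Lemma regular_groupoid_repr : groupoid_repr regular_mx.
Proof.
move=> a b; apply: trmx_inj; apply: row_arrow_ext => s.
rewrite trmx_mul mulmxA arrow_row_regular.
have [bs|bNs] := eqVneq (dom b) (ran s); last first.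
  rewrite mul0mx; case: ifP => ab; last by rewrite trmx0 mulmx0.
  by rewrite arrow_row_regular dom_mul ?(eqP ab) // (negbTE bNs).
rewrite arrow_row_regular ran_mulr //; case: ifP => [/eqP ab|_].
  by rewrite arrow_row_regular dom_mul // bs eqxx mulgA.
by rewrite trmx0 mulmx0.
Qed.

(** The action in the representation g of the element of FS with coordinates v. *)
Definition coef_eval m (g : S -> 'M[F]_m) (v : 'rV[F]_n) : 'M[F]_m :=
  \sum_s v 0 (enum_rank s) *: g s.

Lemma coef_eval_arrow m (g : S -> 'M[F]_m) s : coef_eval g (arrow_row s) = g s.
Proof.
rewrite /coef_eval (bigD1 s) //= mxE !eqxx scale1r big1 ?addr0 // => t tNs.
by rewrite mxE eqxx (inj_eq enum_rank_inj) (negbTE tNs) scale0r.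
Qed.

Lemma coef_eval0 m (g : S -> 'M[F]_m) : coef_eval g 0 = 0.
Proof. by rewrite /coef_eval big1 // => s _; rewrite mxE scale0r. Qed.

Lemma coef_eval_mulmx m (g : S -> 'M[F]_m) v A :
  coef_eval g (v *m A) = \sum_s v 0 (enum_rank s) *: coef_eval g (arrow_row s *m A).
Proof.
rewrite {1}[v]row_sum_arrow mulmx_suml /coef_eval.
under [RHS]eq_bigr do rewrite scaler_sumr.
rewrite [RHS]exchange_big; apply: eq_bigr => t _ /=.
rewrite summxE scaler_suml; apply: eq_bigr => s _.
by rewrite -scalemxAl mxE scalerA.
Qed.

Lemma coef_eval_regular m (g : S -> 'M[F]_m) v s : groupoid_repr g ->
  coef_eval g (v *m (regular_mx s)^T) = g s *m coef_eval g v.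
Proof.
move=> gP; rewrite coef_eval_mulmx mulmx_sumr; apply: eq_bigr => t _.
rewrite -scalemxAr gP arrow_row_regular.
by case: ifP; rewrite ?coef_eval_arrow ?coef_eval0.
Qed.

Lemma sum_idem_regular s :
  (\sum_(e | idem e) arrow_row e) *m (regular_mx s)^T = arrow_row s.
Proof.
rewrite mulmx_suml (bigD1 (dom s)) ?idem_dom //= arrow_row_regular.
rewrite ran_idem ?idem_dom // eqxx mul_dom big1 ?addr0 // => e /andP[ide eNs].
by rewrite arrow_row_regular ran_idem // eq_sym (negbTE eNs).
Qed.

Lemma regular_unit : repr_unit regular_mx = 1%:M.
Proof.
apply: trmx_inj; apply: row_arrow_ext => s.
rewrite -sum_idem_regular -mulmxA -trmx_mul mul_repr_unit ?trmx1 ?mulmx1 //.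
exact: regular_groupoid_repr.
Qed.

(** U is a left ideal of FS on which every irreducible representation vanishes.  By
    induction on the dimension U may be taken minimal, so it affords an irreducible
    representation, which kills U, and U U = 0.  Average a projection p of FS onto U
    to a module endomorphism T of FS with image in U.  On the one hand T maps u in U
    to u times the image of 1, a product of two elements of U, so to 0.  On the
    other hand p is the identity on U, so T acts on U as the sum of the dom s, which
    is injective.  Hence U = 0. *)
Lemma no_killed_left_ideal (U : 'M[F]_n) :
  (forall s, stablemx U (regular_mx s)^T) ->
  (forall (w : 'rV_n) m (g : S -> 'M[F]_m),
     (w <= U)%MS -> groupoid_irr g -> coef_eval g w = 0) ->
  U = 0.
Proof.
have [k] := ubnP (\rank U); elim: k => // k IHk in U *; rewrite ltnS => rU st kill.
apply/eqP; apply: contraT => U0.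
have IH (W : 'M_n) : (W <= U)%MS -> (forall s, stablemx W (regular_mx s)^T) ->
  W = 0 \/ \rank W = \rank U.
  move=> WU Wst; have [->|/eqP rWU] := eqVneq (\rank W) (\rank U); [by right|left].
  apply: IHk => //.
    by apply: leq_trans rU; rewrite ltn_neqAle mxrankS // andbT; apply/eqP.
  by move=> w m g /submx_trans/(_ WU); apply: kill.
pose B := row_base U.
have BU : (B :=: U)%MS by apply: eq_row_base.
pose g s := (B *m (regular_mx s)^T *m pinvmx B)^T.
have gB s : (g s)^T *m B = B *m (regular_mx s)^T.
  by rewrite trmxK mulmxKpV // (eqmxMr _ BU) BU st.
have Bfree := row_base_free U.
have gP : groupoid_repr g.
  move=> a b; apply: trmx_inj; apply: (row_free_inj Bfree).
  rewrite trmx_mul -mulmxA gB mulmxA gB -mulmxA -trmx_mul regular_groupoid_repr.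
  by case: ifP => _; rewrite ?gB // !trmx0 mul0mx mulmx0.
have irr_g : groupoid_irr g.
  split=> // [|W Wst].
    have /existsP // : [exists s, g s != 0].
    apply: contraR U0; rewrite negb_exists => /forallP g0.
    have {}g0 s : B *m (regular_mx s)^T = 0.
      by rewrite -gB; have := g0 s; rewrite negbK => /eqP->; rewrite trmx0 mul0mx.
    rewrite -(eqmx_eq0 BU) -[B]mulmx1 -trmx1 -regular_unit raddf_sum mulmx_sumr.
    by rewrite big1 // => e _; apply: g0.
  have WBU : (W *m B <= U)%MS by rewrite -BU submxMl.
  case: (IH <<W *m B>>%MS).
  - by rewrite genmxE.
  - by move=> s; rewrite (eqmxMr _ (genmxE _)) genmxE -mulmxA -gB mulmxA submxMr.
  - move/eqP; rewrite (eqmx_eq0 (genmxE _)) -(mul0mx _ B) => /eqP/(row_free_inj Bfree).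
    by left.
  by rewrite genmxE mxrankMfree // => rW; right; rewrite /row_full rW.
(* The product of u and w in FS is zero. *)
have UU (u w : 'rV_n) : (u <= U)%MS -> (w <= U)%MS ->
    \sum_s u 0 (enum_rank s) *: (w *m (regular_mx s)^T) = 0.
  move=> uU; rewrite -BU => /submxP[x ->].
  have := congr1 (fun M => x *m M^T *m B) (kill u _ g uU irr_g).
  rewrite trmx0 mulmx0 mul0mx /coef_eval raddf_sum mulmx_sumr mulmx_suml => {2}<-.
  apply: eq_bigr => s _ /=.
  by rewrite linearZ /= -scalemxAr -scalemxAl -!(mulmxA x) gB.
have LP := regular_groupoid_repr; set L := regular_mx in LP *.
(* The projection onto U, written for row vectors, whence p^T below. *)
have [p pU p_id] : exists2 p : 'M_n, (p <= U)%MS &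
    forall w : 'rV_n, (w <= U)%MS -> w *m p = w.
  exists (pinvmx U *m U) => [|w wU]; first exact: submxMl.
  by rewrite mulmxA mulmxKpV.
pose T := average L p^T L.
(* The row of coordinates of the identity of FS. *)
pose eps := \sum_(e | idem e) arrow_row e.
have TU : (eps *m T^T <= U)%MS.
  rewrite raddf_sum mulmx_sumr summx_sub // => s _ /=.
  rewrite !trmx_mul trmxK !mulmxA; apply: submx_trans (st (star s)).
  by apply: submxMr; apply: mulmx_sub.
case/eqP: U0; apply/row_matrixP => i; rewrite row0.
set u := row i U; have uU : (u <= U)%MS by apply: row_sub.
apply: trmx_inj; rewrite trmx0 -[u^T]mul1mx -regular_unit mulmx_suml.
apply: big1 => e _; apply: sum_dom_mul_eq0 => //.
apply: trmx_inj; rewrite trmx0 -[RHS](UU u _ uU TU) trmx_mul trmxK.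
transitivity (u *m T^T).
  rewrite /T /average !linear_sum /=; apply: eq_bigr => s _ /=.
  rewrite !trmx_mul trmxK !mulmxA p_id; last first.
    by apply: submx_trans (st s); apply: submxMr.
  by rewrite -mulmxA -trmx_mul LP dom_star eqxx.
rewrite {1}[u]row_sum_arrow mulmx_suml; apply: eq_bigr => s _.
rewrite -scalemxAl -sum_idem_regular -!mulmxA -!trmx_mul.
by rewrite average_intertwines.
Qed.

(** The left ideal generated by an element killed by all irreducible representations
    satisfies the hypotheses of [no_killed_left_ideal]. *)
Lemma coef_complete (v : S -> F) :
  (forall m (g : S -> 'M[F]_m), groupoid_irr g -> \sum_s v s *: g s = 0) ->
  forall s, v s = 0.
Proof.
move=> v0; pose r : 'rV[F]_n := \row_i v (enum_val i).
have rE s : r 0 (enum_rank s) = v s by rewrite mxE enum_rankK.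
pose U := \matrix_(i < n) (r *m (regular_mx (enum_val i))^T).
have rowU s : arrow_row s *m U = r *m (regular_mx s)^T.
  by rewrite -rowE rowK enum_rankK.
suff U0 : U = 0.
  suff r0 : r = 0 by move=> s; rewrite -rE r0 mxE.
  rewrite -[r]mulmx1 -trmx1 -regular_unit raddf_sum mulmx_sumr big1 // => e _.
  by rewrite -rowU U0 mulmx0.
apply: no_killed_left_ideal => [a|w m g /submxP[x ->] gI].
  apply/row_subP => i; rewrite row_mul rowK -mulmxA -trmx_mul regular_groupoid_repr.
  case: ifP => _; last by rewrite trmx0 mulmx0 sub0mx.
  by rewrite -rowU submxMl.
rewrite coef_eval_mulmx big1 // => s _; rewrite rowU coef_eval_regular; last by case: gI.
rewrite [coef_eval g r](_ : _ = 0) ?mulmx0 ?scaler0 // -(v0 m g gI).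
by apply: eq_bigr => t _; rewrite rE.
Qed.

End Completeness.

(** * Conjugacy classes and the number of irreducible representations *)

Lemma equiv_repr_sym (S : finInverseSemigroupType) (F : fieldType) n m
    (g : S -> 'M[F]_n) (h : S -> 'M[F]_m) : equiv_repr g h -> equiv_repr h g.
Proof.
move=> [A [B [AB BA eq]]]; exists B, A; split=> // s.
by rewrite -[LHS]mulmx1 -AB mulmxA -(mulmxA B) -eq mulmxA BA mul1mx.
Qed.

Section ConjugacyClasses.
Variable S : finInverseSemigroupType.
Implicit Types s t : S.

Lemma conj_stepC s t : conj_step s t = conj_step t s.
Proof.
by apply/existsP/existsP => -[a /existsP[b /andP[ab ba]]];
   exists b; apply/existsP; exists a; rewrite ba ab.
Qed.

Lemma conj_step_mul s t : conj_step (s * t)%g (t * s)%g.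
Proof. by apply/existsP; exists s; apply/existsP; exists t; rewrite !eqxx. Qed.

Lemma connect_conj_equiv :
  {in [set: S] & &, equivalence_rel (connect (@conj_step S))}.
Proof.
have sym : connect_sym (@conj_step S) by apply: sym_connect_sym; apply: conj_stepC.
move=> x y z _ _ _; split=> [|xy]; first exact: connect0.
exact: (same_connect sym xy).
Qed.

Lemma connect_conj_invariant (T : eqType) (f : S -> T) :
  (forall a b, f (a * b)%g = f (b * a)%g) ->
  forall s t, connect (@conj_step S) s t -> f s = f t.
Proof.
move=> fC s t /connectP[p]; elim: p s => [|u p IHp] s /= => [_ -> //|].
case/andP=> /existsP[a /existsP[b /andP[/eqP-> /eqP ->]]] pu tE.
by rewrite fC; apply: IHp.
Qed.

Lemma conj_class_index : exists (cls : S -> 'I_#|conj_classes S|) (rep : _ -> S),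
  [/\ cancel rep cls, forall s, connect (@conj_step S) s (rep (cls s))
    & forall a b, cls (a * b)%g = cls (b * a)%g].
Proof.
have part := equivalence_partitionP connect_conj_equiv.
have [/eqP cov triv n0] := and3P part; rewrite -/(conj_classes S) in part cov triv n0.
have inC s : pblock (conj_classes S) s \in conj_classes S.
  by rewrite pblock_mem // cov inE.
have memE s t : (t \in pblock (conj_classes S) s) = connect (@conj_step S) s t.
  by rewrite (pblock_equivalence_partition connect_conj_equiv) ?inE.
pose cls s := enum_rank_in (inC s) (pblock (conj_classes S) s).
have clsE s : enum_val (cls s) = pblock (conj_classes S) s.
  by rewrite enum_rankK_in.
have repP (k : 'I_#|conj_classes S|) : exists s, s \in enum_val k.
  by apply/set0Pn; apply: contraNneq n0 => <-; apply: enum_valP.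
have [rep repE] := fin_all_exists repP.
have blockE k : pblock (conj_classes S) (rep k) = enum_val k.
  by apply: def_pblock => //; apply: enum_valP.
exists cls, rep; split=> [k|s|a b].
- by apply: enum_val_inj; rewrite clsE blockE.
- by rewrite -memE -clsE repE.
apply: enum_val_inj; rewrite !clsE; apply: same_pblock => //.
by rewrite memE; apply/connect1/conj_step_mul.
Qed.

End ConjugacyClasses.

Section Counting.
Variables (S : finInverseSemigroupType) (F : closedFieldType).
Hypothesis charF : [pchar F] =i pred0.
Implicit Types s t : S.

(** Summed over all a <= s and b <= t, the two sides become the values on s t and on
    t s of the linear form on FS whose values on the arrows are f. *)
Lemma moebius_conj_invariant (V : zmodType) (f : S -> V) :
  (forall s t, nle_sum f (s * t)%g = nle_sum f (t * s)%g) ->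
  forall a b, (if dom a == ran b then f (a * b)%g else 0)
            = (if dom b == ran a then f (b * a)%g else 0).
Proof.
move=> fC; apply: nle_sum2_inj => s t; rewrite /nle_sum sum_nle_mul exchange_big.
by rewrite [RHS]sum_nle_mul; apply: fC.
Qed.

Lemma trace_orthogonal n m (g : S -> 'M[F]_n) (h : S -> 'M[F]_m) :
  groupoid_irr g -> groupoid_irr h -> ~ equiv_repr g h ->
  \sum_s \tr (h (star s)) *: g s = 0.
Proof.
move=> gI hI gNh; apply/matrixP => c d; rewrite summxE mxE.
under eq_bigr do rewrite mxE mulr_suml.
by rewrite exchange_big big1 //= => k _; apply: coef_orthogonal.
Qed.

Lemma trace_orthogonal_self n (g : S -> 'M[F]_n) : groupoid_irr g ->
  exists2 x, x != 0 & \sum_s \tr (g (star s)) *: g s = x%:M.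
Proof.
move=> gI; have [x x0 orth] := coef_orthogonal_self charF gI; exists x => //.
apply/matrixP => c d; rewrite summxE mxE.
under eq_bigr do rewrite mxE mulr_suml.
rewrite exchange_big /=; under eq_bigr do rewrite orth.
rewrite (bigD1 d) //= eqxx /=.
rewrite big1 ?addr0 => [|k /negbTE kNd]; last by rewrite kNd mulr0.
by rewrite mulr_natr eq_sym.
Qed.

(** Both products become sums over the arrows v with the dom or the ran of a; their
    coefficients are the values of f on the two products of a and star v. *)
Lemma conj_invariant_average n (g : S -> 'M[F]_n) (f : S -> F) a :
  (forall s t, nle_sum f (s * t)%g = nle_sum f (t * s)%g) -> groupoid_repr g ->
  g a *m (\sum_s f (star s) *: g s) = (\sum_s f (star s) *: g s) *m g a.
Proof.
move=> /moebius_conj_invariant fC gP; rewrite mulmx_sumr mulmx_suml.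
transitivity (\sum_(v | ran v == ran a) f (star v * a)%g *: g v).
  rewrite (bigID (fun s => ran s == dom a)) /= [X in _ + X]big1 ?addr0; last first.
    by move=> s sNa; rewrite -scalemxAr gP eq_sym (negbTE sNa) scaler0.
  rewrite reindex_mul_star; apply: eq_bigr => v /eqP va.
  rewrite -scalemxAr gP ran_mulr ?dom_star ?va // ran_star eqxx.
  by rewrite mul_mul_star // starM starK.
transitivity (\sum_(v | dom v == dom a) f (a * star v)%g *: g v).
  rewrite big_mkcond [RHS]big_mkcond; apply: eq_bigr => v _.
  have ifZ (b : bool) (y : F) :
    (if b then y *: g v else 0) = (if b then y else 0) *: g v.
    by case: b; rewrite ?scale0r.
  by rewrite !ifZ -dom_star fC ran_star [dom v == _]eq_sym.
rewrite [RHS](bigID (fun u => dom u == ran a)) /= [X in _ = _ + X]big1 ?addr0;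
  last by move=> u uNa; rewrite -scalemxAl gP (negbTE uNa) scaler0.
rewrite reindex_mul; apply: eq_bigr => u /eqP ua.
by rewrite mul_star_mulr // -scalemxAl gP ua eqxx.
Qed.

Section Family.
Variables (r : nat) (d : 'I_r -> nat) (g : forall i, S -> 'M[F]_(d i)).
Hypothesis gI : forall i, groupoid_irr (@g i).
Hypothesis gN : forall i j, equiv_repr (@g i) (@g j) -> i = j.

Definition family_char i s := \tr (nle_sum (@g i) s).

(** The coefficients of a combination of the irreducible characters can be recovered
    from it. *)
Lemma family_trace_orthogonal : exists2 x : 'I_r -> F, forall i, x i != 0 &
  forall c i, \sum_s (\sum_j c j * \tr (g j (star s))) *: g i s = (c i * x i)%:M.
Proof.
have [x x0 xE] := fin_all_exists2 (fun i => trace_orthogonal_self (gI i)).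
exists x => // c i.
under eq_bigr do rewrite scaler_suml.
rewrite exchange_big (bigD1 i) //= [X in _ + X]big1 ?addr0 => [|j jNi].
  by rewrite -scale_scalar_mx -xE scaler_sumr; apply: eq_bigr => s _; rewrite scalerA.
under eq_bigr do rewrite -scalerA.
rewrite -scaler_sumr trace_orthogonal ?scaler0 //.
by move=> /gN ij; rewrite ij eqxx in jNi.
Qed.

Lemma family_char_free (c : 'I_r -> F) :
  (forall s, \sum_i c i * family_char i s = 0) -> forall i, c i = 0.
Proof.
move=> c0 i; have [x x0 xE] := family_trace_orthogonal; have := xE c i.
rewrite big1 => [/matrixP cx|s _].
  have i0 := Ordinal (irr_dim_gt0 (gI i)).
  have /eqP := cx i0 i0; rewrite !mxE eqxx eq_sym mulf_eq0 (negbTE (x0 i)) orbF.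
  by move/eqP.
rewrite [X in X *: _](_ : _ = 0) ?scale0r //; move: (star s).
apply: (nle_sum_inj (h := fun=> 0)) => t.
rewrite /nle_sum exchange_big [RHS]big1 //= -[RHS](c0 t); apply: eq_bigr => j _.
by rewrite -mulr_sumr /family_char /nle_sum raddf_sum.
Qed.

Lemma family_char_conj i s t : family_char i (s * t)%g = family_char i (t * s)%g.
Proof.
have [gP _ _] := gI i.
by rewrite /family_char !(nle_sum_repr gP) mxtrace_mulC.
Qed.

(** The characters are linearly independent functions on the set of classes. *)
Lemma family_size_le : (r <= #|conj_classes S|)%N.
Proof.
have [cls [rep [repK clsP clsC]]] := @conj_class_index S.
pose K : 'M[F]_(r, #|conj_classes S|) := \matrix_(i, k) family_char i (rep k).
suff <- : \rank K = r by apply: rank_leq_col.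
apply/eqP/inj_row_free => v vK; apply/rowP => i; rewrite mxE; move: i.
apply: family_char_free => s; have := congr1 (fun M : 'rV_ _ => M 0 (cls s)) vK.
rewrite !mxE => vKs; rewrite -[RHS]vKs; apply: eq_bigr => i _; rewrite mxE; congr (_ * _).
exact: connect_conj_invariant (family_char_conj i) _ _ (clsP s).
Qed.

Hypothesis g_complete : forall n (h : S -> 'M[F]_n),
  groupoid_irr h -> exists i, equiv_repr h (@g i).

Lemma family_complete (v : S -> F) :
  (forall i, \sum_s v s *: g i s = 0) -> forall s, v s = 0.
Proof.
move=> v0; apply: coef_complete => // m h /g_complete[i [A [B [AB BA eq]]]].
rewrite -[LHS]mul1mx -BA -mulmxA mulmx_sumr.
under eq_bigr do rewrite -scalemxAr eq scalemxAl.
by rewrite -mulmx_suml v0 mul0mx mulmx0.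
Qed.

(** For a class function f with values f' on the arrows, the sum of f' (star s) g_i s
    is an endomorphism of g_i, so a scalar m_i by Schur's lemma.  A suitable
    combination of the irreducible characters has the same scalars, and a function
    all of whose scalars vanish is 0 by completeness. *)
Lemma family_char_span (f : S -> F) :
  (forall s t, f (s * t)%g = f (t * s)%g) ->
  exists c : 'I_r -> F, forall s, f s = \sum_i c i * family_char i s.
Proof.
move=> fC; pose f' : S -> F^o := nle_moebius (f : S -> F^o).
have f'E s : nle_sum f' s = f s by apply: nle_moebiusK.
have f'C s t : nle_sum f' (s * t)%g = nle_sum f' (t * s)%g by rewrite !f'E fC.
have mP i : exists m, \sum_s f' (star s) *: g i s = m%:M.
  apply: (schur_scalar (gI i)) => a; apply: conj_invariant_average => //.
  by have [] := gI i.
have [m mE] := fin_all_exists mP; have [x x0 xE] := family_trace_orthogonal.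
pose c i := m i / x i; exists c.
have f'_sum s : f' s = \sum_j c j * \tr (g j s).
  rewrite -[s]starK; apply/eqP; rewrite -subr_eq0; apply/eqP; move: (star s) => {}s.
  apply: (family_complete (v := fun s => f' (star s) - _)) => i; move: s => _.
  under eq_bigr do rewrite scalerBl.
  by rewrite big_split sumrN /= mE xE /c divfK // subrr.
move=> s; rewrite -f'E /nle_sum; under eq_bigr do rewrite f'_sum.
rewrite exchange_big; apply: eq_bigr => j _ /=.
by rewrite -mulr_sumr /family_char /nle_sum raddf_sum.
Qed.

Lemma family_size : r = #|conj_classes S|.
Proof.
apply/eqP; rewrite eqn_leq family_size_le /=.
have [cls [rep [repK clsP clsC]]] := @conj_class_index S.
pose K : 'M[F]_(r, #|conj_classes S|) := \matrix_(i, k) family_char i (rep k).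
suff /eqP <- : row_full K by apply: rank_leq_row.
rewrite -sub1mx; apply/row_subP => k; set x := row k _.
have [|c cE] := @family_char_span (fun s => x 0 (cls s)).
  by move=> s t; rewrite clsC.
apply/submxP; exists (\row_i c i); apply/rowP => l.
rewrite -{1}[l]repK cE mxE; by apply: eq_bigr => i _; rewrite !mxE.
Qed.

End Family.

(** A family of pairwise inequivalent irreducible representations has at most as many
    members as there are classes, so it can be enlarged until it is complete. *)
Lemma exists_complete_family :
  exists (d : 'I_#|conj_classes S| -> nat) (g : forall i, S -> 'M[F]_(d i)),
  [/\ forall i, groupoid_irr (g i), forall i j, equiv_repr (g i) (g j) -> i = j
    & forall n (h : S -> 'M[F]_n), groupoid_irr h -> exists i, equiv_repr h (g i)].
Proof.
pose rep := {n : nat & S -> 'M[F]_n}.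
pose indep r (fam : 'I_r -> rep) := (forall i, groupoid_irr (projT2 (fam i))) /\
  (forall i j, equiv_repr (projT2 (fam i)) (projT2 (fam j)) -> i = j).
suff [r [fam [famI famN famC]]] : exists r (fam : 'I_r -> rep),
    [/\ forall i, groupoid_irr (projT2 (fam i)),
        forall i j, equiv_repr (projT2 (fam i)) (projT2 (fam j)) -> i = j
      & forall n (h : S -> 'M[F]_n), groupoid_irr h ->
          exists i, equiv_repr h (projT2 (fam i))].
  have rE := family_size famI famN famC; subst r.
  by exists (fun i => projT1 (fam i)), (fun i => projT2 (fam i)).
have IH k : forall r (fam : 'I_r -> rep), indep r fam -> (#|conj_classes S| - r < k)%N ->
    exists r' fam', indep r' fam' /\ forall n (h : S -> 'M[F]_n), groupoid_irr h ->
          exists i, equiv_repr h (projT2 (fam' i)).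
  elim: k => // k IHk r fam famP; rewrite ltnS => rk.
  have [full|/existsNP[n /existsNP[h /not_implyP[hI hN]]]] :=
    pselect (forall n (h : S -> 'M[F]_n), groupoid_irr h ->
          exists i, equiv_repr h (projT2 (fam i))).
    by exists r, fam.
  have [famI famN] := famP.
  pose fam' (i : 'I_r.+1) :=
    if unlift ord0 i is Some j then fam j else existT _ n h : rep.
  have fam'P : indep _ fam'.
    split=> [i|i j]; rewrite /fam'; first by case: unliftP.
    case: unliftP => [i'|] ->; case: unliftP => [j'|] -> //=.
    - by move=> /famN->.
    - by move=> /equiv_repr_sym eq; case: hN; exists i'.
    by move=> eq; case: hN; exists j'.
  apply: (IHk _ fam') => //; apply: leq_trans rk.
  have := family_size_le fam'P.1 fam'P.2.
  by move=> lt; rewrite subnS prednK ?subn_gt0.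
have fam0 : indep 0%N (fun=> existT _ 0%N (fun=> 0)) by split=> -[].
have [|r [fam [[famI famN] famC]]] := IH (#|conj_classes S|).+1 _ _ fam0.
  by rewrite subn0.
by exists r, fam.
Qed.

End Counting.

(** * The groupoid determinant as a product of determinants *)

Lemma det_dim0 (R : comPzRingType) n (A : 'M[R]_n) : n = 0%N -> \det A = 1.
Proof. by move=> n0; subst n; rewrite det_mx00. Qed.

Lemma det_castmx (R : comPzRingType) m n (e : m = n) (A : 'M[R]_m) :
  \det (castmx (e, e) A) = \det A.
Proof. by case: n / e. Qed.

Lemma det_mxdiag (R : comPzRingType) m (p : 'I_m -> nat) (B : forall i, 'M[R]_(p i)) :
  \det (\mxdiag_i B i) = \prod_i \det (B i).
Proof.
elim: m p B => [|m IHm] p B.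
  by rewrite det_dim0 ?big_ord0.
by rewrite mxdiag_recl det_castmx det_ublock big_ord_recl IHm.
Qed.

(** A and C are square only up to the propositional equality m = n, so neither has a
    determinant of its own. *)
Lemma det_mul_rotate (R : comPzRingType) m n (A : 'M[R]_(m, n)) (B : 'M[R]_n)
    (C : 'M[R]_(n, m)) :
  m = n -> \det (A *m B *m C) = \det B * \det (C *m A).
Proof. by move=> mn; subst n; rewrite !det_mulmx mulrAC mulrC (mulrC (\det A)). Qed.

Lemma sum_enum_val (T : finType) (V : nmodType) (f : T -> V) :
  \sum_(i < #|T|) f (enum_val i) = \sum_t f t.
Proof.
rewrite [RHS](reindex_onto enum_val enum_rank) => [|t _]; last exact: enum_rankK.
by apply: eq_bigl => i; rewrite enum_valK eqxx.
Qed.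

Lemma map_mxrow (U V : Type) (f : U -> V) m q (p : 'I_q -> nat)
    (B : forall j, 'M[U]_(m, p j)) :
  map_mx f (\mxrow_j B j) = \mxrow_j map_mx f (B j).
Proof. by apply/matrixP => i j; rewrite !mxE. Qed.

(** The action in g of the generic element of FS, the variables being its coordinates
    on the arrows. *)
Definition generic_mx (S : finInverseSemigroupType) (F : fieldType) n
    (g : S -> 'M[F]_n) : 'M[{mpoly F[#|S|]}]_n :=
  \matrix_(j, k) \sum_s g s j k *: var F s.

Section GroupoidDeterminant.
Variables (S : finInverseSemigroupType) (F : closedFieldType).
Hypothesis charF : [pchar F] =i pred0.
Local Notation N := #|S|.
Local Notation poly := {mpoly F[N]}.

Variables (r : nat) (d : 'I_r -> nat) (g : forall i, S -> 'M[F]_(d i)).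
Hypothesis gI : forall i, groupoid_irr (@g i).
Hypothesis gN : forall i j, equiv_repr (@g i) (@g j) -> i = j.
Hypothesis g_complete : forall n (h : S -> 'M[F]_n),
  groupoid_irr h -> exists i, equiv_repr h (@g i).

Let p (n : 'I_(\sum_i d i)) := d (tagnat.sig1 n).

Let block_repr (n : 'I_(\sum_i d i)) : S -> 'M[F]_(p n) := @g (tagnat.sig1 n).

Let coef_block n : 'M[F]_(N, p n) :=
  \matrix_(a, k) block_repr n (enum_val a) (tagnat.sig2 n) k.

(** The columns are the coefficient functions on S of all the representations.  They
    are ordered in blocks: there is one block for each i and each row index j of
    g_i, made of the d_i coefficients in that row. *)
Definition coef_mx : 'M[F]_(N, \sum_n p n) := \mxrow_n coef_block n.

Definition star_mx : 'M[F]_N := rowsub (fun a => enum_rank (star (enum_val a))) 1%:M.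

Lemma star_mxK : star_mx *m star_mx = 1%:M.
Proof.
rewrite /star_mx mul_rowsub_mx mul1mx; apply/matrixP => a b.
by rewrite !mxE enum_rankK starK enum_valK.
Qed.

Lemma coef_mx_entry i (j k : 'I_(d i)) :
  exists b, forall s, coef_mx (enum_rank s) b = g i s j k.
Proof.
suff E (y : {i : 'I_r & 'I_(d i)}) (x : 'I_(d (tag y))) :
    exists b, forall s, coef_mx (enum_rank s) b = g (tag y) s (tagged y) x.
  exact: E (Tagged (fun i => 'I_(d i)) j) k.
(* With y in the form tagnat.sig n, the type of x is convertible to that of the
   column indices of block n, so that no cast is needed. *)
move: x; rewrite -(tagnat.rankK y); set n := tagnat.rank y => x.
exists (tagnat.rank (Tagged (fun n => 'I_(p n)) x)) => s.
by rewrite !mxE enum_rankK /tagnat.sig1 /tagnat.sig2 tagnat.rankK.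
Qed.

Lemma coef_mx_row_full : row_full coef_mx^T.
Proof.
suff : row_free coef_mx by rewrite /row_free /row_full mxrank_tr.
apply/inj_row_free => v vK.
suff v0 s : v 0 (enum_rank s) = 0 by apply/rowP => i; rewrite -(enum_valK i) v0 mxE.
apply: (family_complete charF g_complete (v := fun s => v 0 (enum_rank s))) => i {s}.
apply/matrixP => j k; rewrite summxE mxE.
have [b bE] := coef_mx_entry j k.
have := congr1 (fun M : 'rV_ _ => M 0 b) vK; rewrite !mxE => vb; rewrite -[RHS]vb.
rewrite -[LHS]sum_enum_val; apply: eq_bigr => l _.
by rewrite mxE -bE enum_valK.
Qed.

(** Orthogonality says that a suitable rearrangement W of the coefficients is, up to
    nonzero scalars, a right inverse. *)
Lemma coef_mx_row_free : row_free coef_mx^T.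
Proof.
pose W : 'M[F]_(N, \sum_n p n) := \mxrow_n
  \matrix_(a, k) block_repr n (star (enum_val a)) k (tagnat.sig2 n).
have [x x0 xE] : exists2 x : 'I_r -> F, forall i, x i != 0 &
    forall i a b c e, \sum_s g i (star s) a b * g i s c e = x i * ((a == e) && (b == c))%:R.
  exact: fin_all_exists2 (fun i => coef_orthogonal_self charF (gI i)).
have TW a b : (coef_mx^T *m W) a b =
    x (tagnat.sig1 (tagnat.sig1 a)) * (a == b)%:R.
  rewrite -(can_eq tagnat.sigK) !mxE.
  transitivity (\sum_s block_repr (tagnat.sig1 b) (star s) (tagnat.sig2 b)
    (tagnat.sig2 (tagnat.sig1 b)) * block_repr (tagnat.sig1 a) s
     (tagnat.sig2 (tagnat.sig1 a)) (tagnat.sig2 a)).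
    by rewrite -[RHS]sum_enum_val; apply: eq_bigr => i _; rewrite !mxE mulrC.
  rewrite /tagnat.sig1 /tagnat.sig2.
  case: (tagnat.sig a) => n k; case: (tagnat.sig b) => m l /= {a b}.
  have [mn|mNn] := eqVneq m n.
    subst m; transitivity (x (tagnat.sig1 n) * ((l == k) && (tagnat.sig2 n == tagnat.sig2 n))%:R).
      exact: xE.
    by rewrite eqxx andbT eq_sym eq_Tagged.
  rewrite [_ == _](_ : _ = false) ?mulr0; last first.
    by apply: contraNF mNn => /eqP/(congr1 tag) /= ->.
  have: tagnat.sig m != tagnat.sig n by rewrite (can_eq tagnat.sigK).
  rewrite /block_repr /tagnat.sig1; move: k l; rewrite /p /tagnat.sig1.
  case: (tagnat.sig n) => i j; case: (tagnat.sig m) => i' j' /= k l.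
  have [ii|iNi _] := eqVneq i' i; last first.
    by apply: coef_orthogonal => // /gN ii; rewrite ii eqxx in iNi.
  by subst i'; rewrite eq_Tagged /= xE => /negbTE->; rewrite andbF mulr0.
apply/inj_row_free => v vT; apply/rowP => b.
have := congr1 (fun M : 'rV_ _ => (M *m W) 0 b) vT.
rewrite mul0mx -mulmxA !mxE (bigD1 b) //= TW eqxx mulr1 [X in _ + X]big1 => [/eqP|c cNb].
  by rewrite addr0 mulf_eq0 (negbTE (x0 _)) orbF => /eqP.
by rewrite TW (negbTE cNb) !mulr0.
Qed.

Lemma coef_mx_inv : exists W, W *m coef_mx = 1%:M /\ coef_mx *m W = 1%:M.
Proof.
exists (pinvmx coef_mx^T)^T; split; apply: trmx_inj; rewrite trmx_mul trmxK trmx1.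
  exact: mulmxVp coef_mx_row_free.
exact: mulVpmx coef_mx_row_full.
Qed.

(** Row a of the left-hand side is the sum over b of y_(a b) g_i b, that is, the sum
    over v of y_v g_i (star a) g_i v: this is g_i (star a) times the generic matrix. *)
Lemma groupoid_mx_coef :
  let Y := \matrix_(i < N, j < N)
     let a := enum_val i in let b := enum_val j in
     if dom a == ran b then var F (a * b)%g else 0 in
  Y *m map_mx (@mpolyC N F) coef_mx =
  map_mx (@mpolyC N F) (star_mx *m coef_mx) *m
    \mxdiag_n generic_mx (block_repr n).
Proof.
move=> Y; rewrite /coef_mx mul_mxrow !map_mxrow mul_mxrow mul_mxrow_mxdiag.
apply: eq_mxrow => n; rewrite /star_mx mul_rowsub_mx mul1mx.
have hP : groupoid_repr (block_repr n) by have [] := gI (tagnat.sig1 n).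
rewrite /coef_block; move: (block_repr n) (tagnat.sig2 n) hP => h j hP.
apply/matrixP => i k; rewrite !mxE; set a := enum_val i.
transitivity (\sum_(v | ran v == ran a) h (star a * v)%g j k *: var F v).
  transitivity (\sum_(b | ran b == dom a) h b j k *: var F (a * b)%g).
    rewrite [RHS]big_mkcond -[RHS]sum_enum_val; apply: eq_bigr => b _.
    rewrite !mxE -/a /= [dom a == _]eq_sym; case: ifP; rewrite ?mul0r // => _.
    by rewrite mulrC mul_mpolyC.
  by rewrite reindex_mul_star; apply: eq_bigr => v /eqP va; rewrite mul_mul_star.
under [RHS]eq_bigr do rewrite !mxE enum_rankK -/a mulr_sumr.
rewrite exchange_big /= big_mkcond; apply: eq_bigr => v _ /=.
under eq_bigr do rewrite mul_mpolyC scalerA.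
rewrite -scaler_suml; have := congr1 (fun M : 'M_ _ => M j k) (hP (star a) v).
rewrite mxE => ->; rewrite dom_star eq_sym.
by case: ifP => // _; rewrite mxE scale0r.
Qed.

(** If K is the coefficient matrix, P the permutation matrix of star and D the block
    diagonal matrix, the groupoid matrix is P K D K^-1.  Its determinant is that of
    D times that of K^-1 P K, which is an involution. *)
Lemma theta_groupoid_factor : exists2 c : F, c != 0 &
  theta_groupoid S F = c *: \prod_i \det (generic_mx (@g i)) ^+ d i.
Proof.
have [W [WK KW]] := coef_mx_inv.
have NE : N = (\sum_n p n)%N.
  have /eqP <- := coef_mx_row_free.
  by apply/esym/eqP; apply: coef_mx_row_full.
pose E := W *m (star_mx *m coef_mx).
have EE : E *m E = 1%:M.
  rewrite /E -!mulmxA (mulmxA coef_mx) KW mul1mx (mulmxA star_mx) star_mxK mul1mx.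
  exact: WK.
exists (\det E).
  by have := congr1 determinant EE; rewrite det_mulmx det1; apply: contra_eq_neq => ->;
     rewrite mul0r eq_sym oner_neq0.
transitivity (\det (\mxdiag_n generic_mx (block_repr n)) *
   \det (map_mx (@mpolyC N F) E)).
  rewrite /E map_mxM -det_mul_rotate // -groupoid_mx_coef -mulmxA -map_mxM KW.
  by rewrite map_mx1 mulmx1.
rewrite det_map_mx mulrC mul_mpolyC det_mxdiag; congr (_ *: _).
rewrite (reindex tagnat.rank) /=; last first.
  by exists tagnat.sig => x _; rewrite (tagnat.rankK, tagnat.sigK).
transitivity (\prod_(x : {i : 'I_r & 'I_(d i)}) \det (generic_mx (g (tag x)))).
  apply: eq_bigr => x _; rewrite -[in RHS](tagnat.rankK x).
  by [].
rewrite [RHS](eq_bigr (fun i => \prod_(j < d i) \det (generic_mx (@g i)))).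
  by rewrite sig_big_dep.
by move=> i _; rewrite prodr_const card_ord.
Qed.

End GroupoidDeterminant.

(** * Irreducibility of the generic determinant *)

Lemma rmorph_mpoly_ext (m : nat) (R : comNzRingType) (A : comNzRingType)
    (f h : {rmorphism {mpoly R[m]} -> A}) :
  (forall c, f c%:MP = h c%:MP) -> (forall i, f 'X_i = h 'X_i) -> f =1 h.
Proof.
move=> fC fX p; rewrite (mpolyE p) !rmorph_sum; apply: eq_bigr => u _ /=.
rewrite -mul_mpolyC !rmorphM fC mpolyXE_id !rmorph_prod; congr (_ * _).
by apply: eq_bigr => i _; rewrite !rmorphXn /= fX.
Qed.

Lemma comp_mpoly_tupleX (m k : nat) (R : comNzRingType) (z : 'I_m -> {mpoly R[k]}) i :
  'X_i \mPo [tuple z i | i < m] = z i.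
Proof. by rewrite /comp_mpoly mmapX mmap1U tnth_mktuple. Qed.

Lemma irreducible_iso (A B : idomainType) (f : {rmorphism A -> B})
    (h : {rmorphism B -> A}) (p : A) :
  cancel f h -> cancel h f -> irreducible_elt p -> irreducible_elt (f p).
Proof.
move=> fK hK [p0 pU pI]; split.
- by rewrite -(rmorph0 f) (can_eq fK).
- by apply: contra pU => fpU; rewrite -(fK p) rmorph_unit.
move=> a b /(congr1 h); rewrite fK rmorphM => /pI[] U; [left|right].
  by rewrite -(hK a) rmorph_unit.
by rewrite -(hK b) rmorph_unit.
Qed.

Lemma irreducible_mul_unit (A : idomainType) (u p : A) :
  u \is a GRing.unit -> irreducible_elt p -> irreducible_elt (u * p).
Proof.
move=> uU [p0 pU pI]; split.
- by rewrite mulf_neq0 //; apply: contraTneq uU => ->; rewrite unitr0.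
- by rewrite unitrM uU.
move=> a b upE; have /pI[] : p = (u^-1 * a) * b by rewrite -mulrA -upE mulKr.
  by rewrite unitrM unitrV uU; left.
by right.
Qed.

Section GenericDeterminant.
Variables (F : fieldType) (m : nat).
Local Notation poly := {mpoly F[m]}.
Implicit Types (V U : pred 'I_m) (p a b : poly).

Definition zero_vars V p : poly := p \mPo [tuple (if V i then 0 else 'X_i) | i < m].

HB.instance Definition _ V := GRing.RMorphism.copy (zero_vars V)
  (comp_mpoly [tuple (if V i then 0 else 'X_i) | i < m]).

Lemma zero_varsX V i : zero_vars V 'X_i = if V i then 0 else 'X_i.
Proof. by rewrite /zero_vars comp_mpoly_tupleX. Qed.

Lemma zero_varsC V c : zero_vars V c%:MP = c%:MP.
Proof. exact: comp_mpolyC. Qed.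

(** Multiplying the variables in V by an additional variable T, which is the 'X of
    the outer polynomials: the degree in T is the degree in the variables of V.  As
    this is a ring morphism into polynomials over a domain, that degree is additive
    on products. *)
Definition scale_vars V : poly -> {poly poly} :=
  mmap (polyC \o @mpolyC m F) (fun i => if V i then 'X * ('X_i)%:P else ('X_i)%:P).

HB.instance Definition _ V := GRing.RMorphism.copy (scale_vars V)
  (mmap (polyC \o @mpolyC m F) (fun i => if V i then 'X * ('X_i)%:P else ('X_i)%:P)).

Lemma scale_varsX V i :
  scale_vars V 'X_i = if V i then 'X * ('X_i)%:P else ('X_i)%:P.
Proof. by rewrite /scale_vars mmapX mmap1U. Qed.

Lemma scale_varsC V c : scale_vars V c%:MP = (c%:MP)%:P.
Proof. exact: mmapC. Qed.

Lemma scale_vars_horner0 V p : (scale_vars V p).[0] = zero_vars V p.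
Proof.
pose f : {rmorphism poly -> poly} := horner_eval (0 : poly) \o scale_vars V.
apply: (rmorph_mpoly_ext (f := f)) => [c|i] /=.
  by rewrite scale_varsC horner_evalE hornerC zero_varsC.
by rewrite scale_varsX zero_varsX horner_evalE; case: ifP; rewrite !hornerE // mul0r.
Qed.

Lemma scale_vars_horner1 V p : (scale_vars V p).[1] = p.
Proof.
pose f : {rmorphism poly -> poly} := horner_eval (1 : poly) \o scale_vars V.
apply: (rmorph_mpoly_ext (f := f) (h := idfun)) => [c|i] /=.
  by rewrite scale_varsC horner_evalE hornerC.
by rewrite scale_varsX horner_evalE; case: ifP; rewrite !hornerE // mul1r.
Qed.

Lemma zero_vars_comp V U p :
  zero_vars V (zero_vars U p) = zero_vars (predU V U) p.
Proof.
apply: (rmorph_mpoly_ext (f := zero_vars V \o zero_vars U)) => [c|i] /=.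
  by rewrite !zero_varsC.
by rewrite !zero_varsX /=; case: (U i); rewrite ?orbT ?rmorph0 // orbF zero_varsX.
Qed.

(** The variables in V do not occur in p. *)
Definition free_of V p := zero_vars V p = p.

Lemma eq_free_of V U p : V =1 U -> free_of V p -> free_of U p.
Proof.
rewrite /free_of => VU Vp; rewrite -[RHS]Vp; congr (p \mPo _).
by apply: eq_from_tnth => i; rewrite !tnth_mktuple VU.
Qed.

Lemma sub_free_of V U p : {subset V <= U} -> free_of U p -> free_of V p.
Proof.
move=> VU Up; rewrite /free_of -{1}Up zero_vars_comp; apply: eq_free_of Up => i /=.
by case: (boolP (V i)) => // /VU; rewrite unfold_in.
Qed.

Lemma free_ofM V a b : free_of V a -> free_of V b -> free_of V (a * b).
Proof. by rewrite /free_of rmorphM /= => -> ->. Qed.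

(** Setting the variables to zero one after the other leaves p unchanged. *)
Lemma free_of_all p : (forall i, free_of (pred1 i) p) -> exists c, p = c%:MP.
Proof.
move=> pf; exists p.@[fun=> 0].
have {pf} pf : free_of (fun i => i \in enum 'I_m) p.
  elim: (enum _) => [|i s IHs]; first by rewrite /free_of -[RHS]comp_mpoly_id.
  apply: (@eq_free_of (predU (pred1 i) (fun j => j \in s))) => [j|].
    by rewrite inE.
  by rewrite /free_of -(zero_vars_comp (pred1 i)) IHs; apply: pf.
rewrite -[LHS]pf.
pose V i := i \in enum 'I_m.
apply: (rmorph_mpoly_ext (f := zero_vars V) (h := @mpolyC m F \o meval (fun=> 0))).
  by move=> c; rewrite /= zero_varsC mevalC.
by move=> i; rewrite /= zero_varsX mevalXU mpolyC0 /V mem_enum.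
Qed.

Let polyseq_gt0 (q : {poly poly}) : q != 0 -> (0 < size q)%N.
Proof. by rewrite size_poly_gt0. Qed.

Lemma scale_vars_neq0 V p : p != 0 -> scale_vars V p != 0.
Proof. by apply: contraNneq => Vp; rewrite -(scale_vars_horner1 V p) Vp horner0. Qed.

Lemma free_of_size V p : (size (scale_vars V p) <= 1)%N -> free_of V p.
Proof.
move=> /size1_polyC pE; rewrite /free_of -scale_vars_horner0.
by rewrite -[RHS](scale_vars_horner1 V) pE !hornerC.
Qed.

(** The degrees of a and b in the variables of V add up to 0. *)
Lemma free_of_factors V a b : a != 0 -> b != 0 ->
  (size (scale_vars V (a * b)) <= 1)%N -> free_of V a /\ free_of V b.
Proof.
move=> /(scale_vars_neq0 V) a0 /(scale_vars_neq0 V) b0.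
rewrite (rmorphM (scale_vars V)) (size_mul a0 b0).
have {a0 b0}[a0 b0] := (polyseq_gt0 a0, polyseq_gt0 b0).
have le11 x y : (0 < x -> 0 < y -> (x + y).-1 <= 1 -> (x <= 1) /\ (y <= 1))%N.
  by case: x y => [|[|x]] [|[|y]] //; rewrite !addSn ?addnS.
by case/(le11 _ _ a0 b0) => /free_of_size aV /free_of_size bV.
Qed.

(** The degrees of a and b in the variables of V add up to at most 1. *)
Lemma free_of_factor V a b : a != 0 -> b != 0 ->
  (size (scale_vars V (a * b)) <= 2)%N -> free_of V a \/ free_of V b.
Proof.
move=> /(scale_vars_neq0 V) a0 /(scale_vars_neq0 V) b0.
rewrite (rmorphM (scale_vars V)) (size_mul a0 b0).
have {a0 b0}[a0 b0] := (polyseq_gt0 a0, polyseq_gt0 b0) => ab.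
have le12 x y : (0 < x -> 0 < y -> (x + y).-1 <= 2 -> (x <= 1) \/ (y <= 1))%N.
  by case: x y => [|[|x]] [|[|y]] //; rewrite ?addSn ?addnS; [left|left|right|].
by case: (le12 _ _ a0 b0 ab) => /free_of_size; [left|right].
Qed.

Section Irreducible.
Variables (n : nat) (v : 'I_n -> 'I_n -> 'I_m).
Hypothesis v_inj : forall j k j' k', v j k = v j' k' -> j = j' /\ k = k'.

Definition var_mx : 'M[poly]_n := \matrix_(j, k) 'X_(v j k).
Local Notation D := (\det var_mx).

(** The point sets the variables at the positions (l, s l) to 1, all others to 0. *)
Lemma var_mx_perm (s : 'S_n) :
  map_mx (meval (fun i => \sum_l (v l (s l) == i)%:R)) var_mx = perm_mx s :> 'M[F]_n.
Proof.
apply/matrixP => j k; rewrite !mxE mevalXU (bigD1 j) //= big1 ?addr0 => [|l lNj].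
  by congr (_ %:R); congr nat_of_bool; apply/eqP/eqP => [/v_inj[]|->].
by case: eqP => // /v_inj[lj _]; rewrite lj eqxx in lNj.
Qed.

Lemma det_var_mx_eval (s : 'S_n) :
  D.@[fun i => \sum_l (v l (s l) == i)%:R] != 0.
Proof. by rewrite -det_map_mx var_mx_perm det_perm signr_eq0. Qed.

Lemma det_var_mx_neq0 : D != 0.
Proof. by apply: contraNneq (det_var_mx_eval 1) => ->; rewrite meval0. Qed.

(** The determinant is 1 or -1 at the permutation matrix of the transposition of j
    and k; with the entry at (j, k) replaced by 0, row j of that matrix vanishes. *)
Lemma det_var_mx_not_free j k : ~ free_of (pred1 (v j k)) D.
Proof.
move=> Dfree; have /negP := det_var_mx_eval (tperm j k); apply.
rewrite -Dfree /zero_vars comp_mpoly_meval -det_map_mx (expand_det_row _ j) big1 // => l _.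
rewrite !mxE /= mevalXU tnth_mktuple /=; case: eqP => [_|vl]; first by rewrite meval0 mul0r.
rewrite mevalXU big1 ?mul0r // => i _; case: eqP => // /v_inj[ij].
by rewrite ij tpermL => kl; case: vl; rewrite kl.
Qed.

(** Scaling rows, or scaling columns, by T multiplies the determinant by a power of
    T; u and w select them, and one of the two selections is empty. *)
Lemma size_scale_det (V : pred 'I_m) (u w : 'I_n -> bool) :
  (forall j k, V (v j k) = u j || w k) -> (forall j k, ~~ (u j && w k)) ->
  (size (scale_vars V D) <= (\sum_j u j + \sum_k w k).+1)%N.
Proof.
move=> Vuw uw; pose x (b : bool) : {poly poly} := if b then 'X else 1.
have -> : scale_vars V D = (\prod_j x (u j)) * (\prod_k x (w k)) * D%:P.
  rewrite -!det_map_mx.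
  have -> : map_mx (scale_vars V) var_mx =
      diag_mx (\row_j x (u j)) *m map_mx polyC var_mx *m diag_mx (\row_k x (w k)).
    apply/matrixP => j k; rewrite mul_mx_diag [RHS]mxE mul_diag_mx !mxE /= scale_varsX Vuw.
    have := uw j k; rewrite /x; move: (polyC 'X_(v j k)) => q.
    case: (u j); case: (w k) => // _ /=; first by rewrite mulr1.
      by rewrite mul1r mulrC.
    by rewrite mul1r mulr1.
  rewrite !det_mulmx !det_diag mulrAC; congr (_ * _ * _).
    by apply: eq_bigr => j _; rewrite mxE.
  by apply: eq_bigr => j _; rewrite mxE.
have xE (f : 'I_n -> bool) : \prod_j x (f j) = 'X^(\sum_j f j)%N.
  rewrite -prodrXr.
  by apply: eq_bigr => j _; rewrite /x; case: (f j).
rewrite !xE -exprD -mulrC mul_polyC; apply: leq_trans (size_scale_leq _ _) _.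
by rewrite size_polyXn.
Qed.

(** If b does not involve row j then a involves, hence b does not involve, each column
    k, as the variable at (j, k) occurs in the product.  So b involves none of the
    matrix entries; the other variables do not occur in the product at all. *)
Lemma det_var_mx_unit_factor j a b :
  D = a * b -> free_of [pred i | [exists k, v j k == i]] b -> b \is a GRing.unit.
Proof.
move=> Dab b_row; have := det_var_mx_neq0; rewrite Dab mulf_eq0 => /norP[a0 b0].
have b_col k : free_of [pred i | [exists l, v l k == i]] b.
  have [|a_col|//] := @free_of_factor [pred i | [exists l, v l k == i]] a b a0 b0.
    rewrite -Dab; apply: leq_trans (size_scale_det (u := xpred0) (w := pred1 k) _ _) _.
    - move=> l l' /=; apply/existsP/eqP => [[i /eqP/v_inj[]]|->] //.
      by exists l.
    - by [].
    by rewrite sum_nat_const muln0 (bigD1 k) //= eqxx big1 // => l /negbTE->.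
  case: (@det_var_mx_not_free j k); rewrite Dab; apply: free_ofM.
    by apply: sub_free_of a_col => i; rewrite !inE => /eqP->; apply/existsP; exists j.
  by apply: sub_free_of b_row => i; rewrite !inE => /eqP->; apply/existsP; exists k.
have [i|c bc] := @free_of_all b.
  have [/existsP[l /existsP[k /eqP vi]]|] := boolP [exists l, exists k, v l k == i].
    apply: sub_free_of (b_col k) => i'; rewrite !inE => /eqP->.
    by apply/existsP; exists l; rewrite vi.
  rewrite negb_exists => /forallP vi.
  case: (@free_of_factors (pred1 i) a b a0 b0) => //; rewrite -Dab.
  apply: leq_trans (size_scale_det (u := xpred0) (w := xpred0) _ _) _ => //.
    by move=> l k /=; have := vi l; rewrite negb_exists => /forallP/(_ k)/negbTE.
  by rewrite !sum_nat_const !muln0.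
rewrite bc rmorph_unit // unitfE; apply: contraNneq b0 => c0.
by rewrite bc c0 mpolyC0.
Qed.

Lemma det_var_mx_irreducible : (0 < n)%N -> irreducible_elt D.
Proof.
move=> n0; have j := Ordinal n0; split; first exact: det_var_mx_neq0.
  apply/negP; rewrite unfold_in => /andP[/eqP Dc _].
  by case: (@det_var_mx_not_free j j); rewrite Dc /free_of zero_varsC.
move=> a b Dab; have := det_var_mx_neq0; rewrite Dab mulf_eq0 => /norP[a0 b0].
have [|a_row|b_row] := @free_of_factor [pred i | [exists k, v j k == i]] a b a0 b0.
- rewrite -Dab; apply: leq_trans (size_scale_det (u := pred1 j) (w := xpred0) _ _) _.
  + move=> l l' /=; rewrite orbF; apply/existsP/eqP => [[i /eqP/v_inj[]]|->] //.
    by exists l'.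
  + by move=> l k; rewrite /= andbF.
  by rewrite sum_nat_const muln0 addn0 (bigD1 j) //= eqxx big1 // => l /negbTE->.
- by left; apply: (@det_var_mx_unit_factor j b a) => //; rewrite mulrC.
by right; apply: (@det_var_mx_unit_factor j a b).
Qed.

End Irreducible.

End GenericDeterminant.

(** * Linear changes of variables and derivatives of determinants *)

Section LinearSubstitution.
Variable F : fieldType.

Definition lin_subst m n (A : 'M[F]_(m, n)) (p : {mpoly F[m]}) : {mpoly F[n]} :=
  p \mPo [tuple \sum_s A b s *: 'X_s | b < m].

HB.instance Definition _ m n A := GRing.RMorphism.copy (@lin_subst m n A)
  (comp_mpoly [tuple \sum_s A b s *: 'X_s | b < m]).

Lemma lin_substX m n (A : 'M[F]_(m, n)) b :
  lin_subst A 'X_b = \sum_s A b s *: 'X_s.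
Proof. exact: comp_mpoly_tupleX. Qed.

Lemma lin_substM m n k (A : 'M[F]_(m, n)) (B : 'M[F]_(n, k)) p :
  lin_subst B (lin_subst A p) = lin_subst (A *m B) p.
Proof.
apply: (rmorph_mpoly_ext (f := lin_subst B \o lin_subst A)) => [c|b] /=.
  by rewrite /lin_subst !comp_mpolyC.
rewrite !lin_substX rmorph_sum /=.
under eq_bigr do rewrite /lin_subst comp_mpolyZ -/(lin_subst _ _) lin_substX scaler_sumr.
rewrite exchange_big; apply: eq_bigr => t _ /=.
by rewrite mxE scaler_suml; apply: eq_bigr => s _; rewrite scalerA.
Qed.

Lemma lin_subst1 m (p : {mpoly F[m]}) : lin_subst 1%:M p = p.
Proof.
apply: (rmorph_mpoly_ext (f := lin_subst 1%:M) (h := idfun)) => [c|b] /=.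
  exact: comp_mpolyC.
rewrite lin_substX (bigD1 b) //= mxE eqxx scale1r big1 ?addr0 // => s sNb.
by rewrite mxE eq_sym (negbTE sNb) scale0r.
Qed.

(** An invertible linear change of variables, possibly between polynomial rings whose
    numbers of variables are only provably equal. *)
Lemma irreducible_lin_subst m n (A : 'M[F]_(m, n)) (B : 'M[F]_(n, m)) p :
  A *m B = 1%:M -> B *m A = 1%:M -> irreducible_elt p -> irreducible_elt (lin_subst A p).
Proof.
move=> AB BA; apply: (irreducible_iso (h := lin_subst B)) => q.
  by rewrite /= lin_substM AB lin_subst1.
by rewrite /= lin_substM BA lin_subst1.
Qed.

End LinearSubstitution.

Lemma mderiv_prod (R : comNzRingType) m n (i : 'I_m) (f : 'I_n -> {mpoly R[m]}) :
  (\prod_k f k)^`M(i) = \sum_k (f k)^`M(i) * \prod_(l | l != k) f l.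
Proof.
elim: n f => [|n IHn] f; first by rewrite !big_ord0 -mpolyC1 mderivC.
rewrite big_ord_recl mderivM IHn [RHS]big_ord_recl; congr (_ * _ + _).
  rewrite [RHS]big_mkcond [RHS]big_ord_recl eqxx /= mul1r.
  exact: eq_bigr.
rewrite mulr_sumr; apply: eq_bigr => k _; rewrite mulrCA; congr (_ * _).
rewrite [RHS]big_mkcond [RHS]big_ord_recl (neq_lift ord0 k); congr (_ * _).
by rewrite big_mkcond; apply: eq_bigr => l _; rewrite (inj_eq lift_inj).
Qed.

(** Jacobi's formula at a point where M is the identity matrix: in the Leibniz expansion
    only the identity permutation has all but one of its factors nonzero, since a
    permutation fixing all points but one is the identity. *)
Lemma mderiv_det (R : comNzRingType) m n (i : 'I_m) (w : 'I_m -> R)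
    (M : 'M[{mpoly R[m]}]_n) :
  (forall j k, (M j k).@[w] = (j == k)%:R) ->
  ((\det M)^`M(i)).@[w] = \sum_k ((M k k)^`M(i)).@[w].
Proof.
move=> Mw; rewrite /determinant (linear_sum (mderiv i)) (rmorph_sum (meval w)) /=.
rewrite (bigD1 (1%g : 'S_n)) //=.
rewrite [X in _ + X]big1 ?addr0 => [|s sN1].
  rewrite odd_perm1 expr0 mul1r mderiv_prod (rmorph_sum (meval w)).
  apply: eq_bigr => k _ /=.
  rewrite mevalM rmorph_prod big1 ?mulr1 ?perm1 // => l _.
  by rewrite /= perm1 Mw eqxx.
have sE : (-1) ^+ s * \prod_k M k (s k) =
    ((-1) ^+ s)%:MP * \prod_k M k (s k) by rewrite rmorphXn rmorphN1.
rewrite sE mderiv_mulC mevalM mderiv_prod (rmorph_sum (meval w)).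
rewrite big1 ?mulr0 // => k _ /=.
rewrite mevalM; have [l lNk sl] : exists2 l, l != k & s l != l.
  have [/existsP[l /andP[]]|] := boolP [exists l, (l != k) && (s l != l)].
    by exists l.
  rewrite negb_exists => /forallP s_fix; case/negP: sN1; apply/eqP/permP => l.
  have fixNk l' : l' != k -> s l' = l'.
    by move=> l'Nk; have := s_fix l'; rewrite l'Nk negbK => /eqP.
  rewrite perm1; have [->|/fixNk //] := eqVneq l k.
  apply/eqP; apply: contraT => skk.
  by have sk := perm_inj (fixNk _ skk); rewrite sk eqxx in skk.
by rewrite rmorph_prod (bigD1 l) //= Mw eq_sym (negbTE sl) mul0r mulr0.
Qed.

Section Substitutions.
Variables (S : finInverseSemigroupType) (F : fieldType).
Local Notation N := #|S|.
Local Notation poly := {mpoly F[N]}.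

HB.instance Definition _ z := GRing.RMorphism.copy (@subst S F z)
  (comp_mpoly [tuple z (enum_val i) | i < N]).

Lemma subst_var (z : S -> poly) s : subst z (var F s) = z s.
Proof. by rewrite /subst /var comp_mpoly_tupleX enum_rankK. Qed.

Lemma substC (z : S -> poly) c : subst z c%:MP = c%:MP.
Proof. exact: comp_mpolyC. Qed.

Lemma substZ (z : S -> poly) c p : subst z (c *: p) = c *: subst z p.
Proof. exact: comp_mpolyZ. Qed.

Lemma subst_ext (A : comNzRingType) (f h : {rmorphism poly -> A}) :
  (forall c, f c%:MP = h c%:MP) -> (forall s, f (var F s) = h (var F s)) -> f =1 h.
Proof.
move=> fC fX; apply: rmorph_mpoly_ext => // i.
by have := fX (enum_val i); rewrite /var enum_valK.
Qed.

Lemma nle_sum_yvar : nle_sum (@yvar S F) =1 @var S F.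
Proof. exact: nle_moebiusK. Qed.

Lemma subst_yvarK : cancel (subst (@yvar S F)) (@in_yvars S F).
Proof.
apply: (subst_ext (f := subst _ \o subst (@yvar S F)) (h := idfun)) => [c|s] /=.
  by rewrite !substC.
rewrite subst_var /yvar rmorph_sum /=.
under eq_bigr do rewrite substZ subst_var.
exact: (moebius_nle_sum (@var S F)).
Qed.

(** With [subst_yvarK]: the substitution x_s := y_s is an automorphism of the
    polynomial ring. *)
Lemma in_yvarsK : cancel (@in_yvars S F) (subst (@yvar S F)).
Proof.
apply: (subst_ext (f := subst (@yvar S F) \o subst _) (h := idfun)) => [c|s] /=.
  by rewrite !substC.
rewrite subst_var rmorph_sum /=.
by under eq_bigr do rewrite subst_var; apply: nle_sum_yvar.
Qed.

(** By [sum_nle_mul], x_(s t) is the sum of y_(a b) over the composable pairs with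
    a <= s and b <= t, so the matrix of theta is Z^T Y Z with Z the zeta matrix and
    Y the groupoid matrix in the variables y. *)
Lemma theta_subst_groupoid : theta S F = subst (@yvar S F) (theta_groupoid S F).
Proof.
pose Z := map_mx (@mpolyC N F) (zeta_mx F (@nle S)).
have Z1 : \det Z = 1.
  rewrite det_map_mx det_zeta_mx ?rmorph1 //; last exact: nle_trans.
    exact: nle_refl.
  exact: nle_anti.
rewrite /theta /theta_groupoid -det_map_mx; set Y := map_mx _ _.
transitivity (\det (Z^T *m Y *m Z)); last by rewrite !det_mulmx det_tr Z1 mul1r mulr1.
congr (\det _); apply/matrixP => i j; rewrite mxE -mulmxA mxE.
rewrite -nle_sum_yvar /nle_sum -sum_nle_mul big_mkcond -[LHS]sum_enum_val.
apply: eq_bigr => a _; rewrite !mxE; case: (nle _ (enum_val i)); last by rewrite mul0r.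
rewrite mul1r big_mkcond -[LHS]sum_enum_val; apply: eq_bigr => b _.
rewrite !mxE; case: (nle _ (enum_val j)); last by rewrite mulr0.
by rewrite mulr1 /=; case: ifP => _; rewrite ?subst_var ?rmorph0.
Qed.

End Substitutions.

(** * The irreducible factors and their characters *)

Lemma det_homog (R : idomainType) m n (M : 'M[{mpoly R[m]}]_n) :
  (forall j k, M j k \is 1.-homog) -> \det M \is n.-homog.
Proof.
move=> M1; apply: rpred_sum => s _; rewrite rpredMsign.
have prod_homog l (f : 'I_l -> {mpoly R[m]}) :
    (forall k, f k \is 1.-homog) -> \prod_k f k \is l.-homog.
  elim: l f => [|l IHl] f f1; first by rewrite big_ord0 dhomog1.
  by rewrite big_ord_recl; apply: (dhomogM (d := 1%N) (e := l)); rewrite ?f1 ?IHl.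
exact: prod_homog.
Qed.

Section CharacterOfFactor.
Variables (S : finInverseSemigroupType) (F : fieldType).
Local Notation N := #|S|.
Local Notation poly := {mpoly F[N]}.

(** For irreducible g these are the irreducible factors of theta, up to scalars. *)
Definition repr_factor n (g : S -> 'M[F]_n) : poly :=
  subst (@yvar S F) (\det (generic_mx g)).

Lemma repr_factor_homog n (g : S -> 'M[F]_n) : repr_factor g \is n.-homog.
Proof.
have homog1 s : var F s \is 1.-homog by rewrite dhomogX /= mdeg1.
rewrite /repr_factor -det_map_mx; apply: det_homog => j k; rewrite !mxE rmorph_sum.
apply: rpred_sum => s _; rewrite /= substZ subst_var; apply: rpredZ.
by apply: rpred_sum => t _; apply/rpredZ/homog1.
Qed.

(** The identity of FS has the coordinates [idem_point], so there the generic matrix is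
    the identity and the logarithmic derivative of its determinant is the trace. *)
Lemma repr_factor_character n (g : S -> 'M[F]_n) c : c != 0 -> groupoid_irr g ->
  determines_character (c *: repr_factor g) (character (nle_sum g)).
Proof.
move=> c0 gI; rewrite /determines_character.
have -> : in_yvars (c *: repr_factor g) = c *: \det (generic_mx g).
  by rewrite /in_yvars substZ; congr (_ *: _); apply: subst_yvarK.
have pt j k : (generic_mx g j k).@[@idem_point S F] = (j == k)%:R.
  have := congr1 (fun M : 'M_ _ => M j k) (irr_repr_unit gI).
  rewrite [RHS]mxE => <-; rewrite !mxE raddf_sum summxE [RHS]big_mkcond.
  apply: eq_bigr => s _ /=; rewrite mevalZ mevalXU /idem_point enum_rankK.
  by case: (idem s); rewrite ?mulr1 ?mulr0.
have det1 : (\det (generic_mx g)).@[@idem_point S F] = 1.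
  rewrite -det_map_mx -(det1 F n); congr (\det _); apply/matrixP => j k.
  by rewrite !mxE -pt mxE.
rewrite mevalZ det1 mulr1; split=> // s.
have derE t : ((c *: \det (generic_mx g))^`M(enum_rank t)).@[@idem_point S F]
    = c * \tr (g t).
  rewrite mderivZ mevalZ; congr (_ * _); rewrite mderiv_det //.
  apply: eq_bigr => k _; rewrite mxE (linear_sum (mderiv _)) (bigD1 t) //=.
  rewrite [X in _ + X]big1 ?addr0 => [|u uNt].
    rewrite mderivZ mevalZ mderivX mnm1E eqxx scale1r -[RHS]mulr1; congr (_ * _).
    by rewrite -{1}[U_(_)%MM]add0m addmK mpolyX0 meval1.
  by rewrite mderivZ mderivX mnm1E (inj_eq enum_rank_inj) (negbTE uNt) scale0r scaler0.
under eq_bigr do rewrite derE.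
by rewrite -mulr_sumr mulrC mulKf // /character /nle_sum raddf_sum.
Qed.

Lemma determines_character_scale (p : poly) c chi chi' : 
  determines_character (c *: p) chi -> determines_character p chi' -> chi =1 chi'.
Proof.
have qE : in_yvars (c *: p) = c *: in_yvars p by apply: substZ.
rewrite /determines_character qE mevalZ mulf_eq0 negb_or.
move=> -[/andP[c0 _] chiE] [_ chiE'] s.
rewrite chiE chiE'; under eq_bigr do rewrite mderivZ mevalZ.
by rewrite -mulr_sumr -mulf_div divff // mul1r.
Qed.

End CharacterOfFactor.

Section Factorization.
Variables (S : finInverseSemigroupType) (F : closedFieldType).
Hypothesis charF : [pchar F] =i pred0.
Local Notation N := #|S|.

Section Family.
Variables (r : nat) (d : 'I_r -> nat) (g : forall i, S -> 'M[F]_(d i)).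
Hypothesis gI : forall i, groupoid_irr (@g i).
Hypothesis gN : forall i j, equiv_repr (@g i) (@g j) -> i = j.
Hypothesis g_complete : forall n (h : S -> 'M[F]_n),
  groupoid_irr h -> exists i, equiv_repr h (@g i).

(** The entries of the generic matrix are distinct columns of the invertible matrix
    [coef_mx], which provides the change of variables. *)
Lemma repr_factor_irreducible i : irreducible_elt (repr_factor (@g i)).
Proof.
apply: (irreducible_iso (f := subst (@yvar S F)) (h := subst _)
          (@subst_yvarK S F) (@in_yvarsK S F)).
have [v vE] := fin_all_exists (fun x : 'I_(d i) * 'I_(d i) => coef_mx_entry g x.1 x.2).
have v_inj j k j' k' : v (j, k) = v (j', k') -> j = j' /\ k = k'.
  move=> vv; have [x x0 xE] := coef_orthogonal_self charF (gI i).
  have : x * ((k == k) && (j == j))%:R = x * ((k == k') && (j == j'))%:R.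
    by rewrite -!xE; apply: eq_bigr => s _; rewrite -(vE (j, k)) vv vE.
  rewrite !eqxx => /(mulfI x0)/eqP.
  by have [->|_] := eqVneq k k'; have [->|_] := eqVneq j j'; rewrite //= oner_eq0.
have [W [WK KW]] := coef_mx_inv charF gI gN g_complete.
have gE : generic_mx (@g i) =
    map_mx (lin_subst (coef_mx g)^T) (var_mx F (fun j k => v (j, k))).
  apply/matrixP => j k; rewrite !mxE /= lin_substX -sum_enum_val.
  by apply: eq_bigr => s _; rewrite mxE -(vE (j, k)) /var enum_valK.
rewrite gE det_map_mx; apply: (irreducible_lin_subst (B := W^T)).
- by rewrite -trmx_mul WK trmx1.
- by rewrite -trmx_mul KW trmx1.
apply: det_var_mx_irreducible; first exact: v_inj.
exact: irr_dim_gt0 (gI i).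
Qed.

Lemma family_irr_representatives : irr_representatives (fun i => nle_sum (@g i)).
Proof.
split=> [i|i j /equiv_nle_sum/gN //|n sigma sI]; first exact: groupoid_irr_sum.
have [i [A [B [AB BA eq]]]] := g_complete (irreducible_moebius sI).
exists i, A, B; split=> // s; rewrite -(nle_moebiusK sigma).
by rewrite /nle_sum mulmx_suml mulmx_sumr; apply: eq_bigr.
Qed.

Lemma family_char_inj i j :
  character (nle_sum (@g i)) =1 character (nle_sum (@g j)) -> i = j.
Proof.
move=> ij; apply/eqP; apply: contraT => iNj.
suff c0 s : \sum_l ((l == i)%:R - (l == j)%:R) * family_char g l s = 0.
  have /eqP := family_char_free charF gI gN c0 i.
  by rewrite eqxx (negbTE iNj) subr0 oner_eq0.
under eq_bigr do rewrite mulrBl.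
have pick k : \sum_l (l == k)%:R * family_char g l s = family_char g k s.
  rewrite (bigD1 k) //= eqxx mul1r big1 ?addr0 // => l /negbTE->.
  by rewrite mul0r.
by rewrite big_split sumrN /= !pick; apply/eqP; rewrite subr_eq0; apply/eqP/ij.
Qed.

(** The scalar in front of the product is absorbed by one of the factors, after
    extraction of a root of order its degree. *)
Lemma theta_factor : exists2 c : 'I_r -> F, forall i, c i != 0 &
  theta S F = \prod_i (c i *: repr_factor (@g i)) ^+ d i.
Proof.
have [e e0 groupoidE] := theta_groupoid_factor charF gI gN g_complete.
have thE : theta S F = e *: \prod_i repr_factor (@g i) ^+ d i.
  rewrite theta_subst_groupoid groupoidE substZ rmorph_prod; congr (_ *: _).
  by apply: eq_bigr => i _; rewrite rmorphXn.
have [i0 _|r0] := pickP 'I_r; last first.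
  exists (fun=> 1) => [i|]; first exact: oner_neq0.
  (* Without irreducible representations there are no classes, so S is empty. *)
  rewrite [RHS]big_pred0 // /theta det_dim0 //; apply: eq_card0 => s.
  have [cls _] := conj_class_index S.
  have rE := esym (family_size charF gI gN g_complete).
  by have := r0 (cast_ord rE (cls s)).
have d0 := irr_dim_gt0 (gI i0).
have [z zE] : exists z : F, z ^+ d i0 = e.
  have [z] : exists z, root ('X^(d i0) - e%:P) z.
    by apply/closed_rootP; rewrite size_XnsubC // eqSS -lt0n.
  by rewrite rootE !hornerE subr_eq0 => /eqP <-; exists z.
exists (fun i => if i == i0 then z else 1) => [i|] /=.
  case: ifP => _; last exact: oner_neq0.
  by apply: contraNneq e0 => z0; rewrite -zE z0 expr0n eqn0Ngt d0.
rewrite thE (bigD1 i0) //= [RHS](bigD1 i0) //= eqxx exprZn zE scalerAl.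
by congr (_ * _); apply: eq_bigr => i /negbTE->; rewrite scale1r.
Qed.

End Family.

Theorem theta_factorization :
  exists (d : 'I_#|conj_classes S| -> nat)
         (rho : forall i, S -> 'M[F]_(d i))
         (P : 'I_#|conj_classes S| -> {mpoly F[N]}),
     [/\ irr_representatives rho,
         theta S F = \prod_i P i ^+ d i,
         (forall i, irreducible_elt (P i) /\ P i \is (d i).-homog),
         (forall i j (c : F), P i = c *: P j -> i = j)
       & (forall i, determines_character (P i) (character (rho i)))].
Proof.
have [d [g [gI gN gC]]] := exists_complete_family S charF.
have [c c0 thE] := theta_factor gI gN gC.
exists d, (fun i => nle_sum (g i)), (fun i => c i *: repr_factor (g i)).
have detc i := repr_factor_character (c0 i) (gI i).
split=> // [|i|i j x Pij].
- exact: family_irr_representatives.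
- split; last by apply: rpredZ; apply: repr_factor_homog.
  rewrite -mul_mpolyC; apply: irreducible_mul_unit.
    by rewrite rmorph_unit // unitfE.
  exact: repr_factor_irreducible gI gN gC i.
apply: (family_char_inj gI gN); 
  apply: (determines_character_scale (c := x) _ (detc j)).
by rewrite -Pij.
Qed.

End Factorization.

Local Open Scope complex_scope.

Theorem theorem3p5 (R : realType) (S : finInverseSemigroupType) :
  (exists (d : 'I_#|conj_classes S| -> nat)
          (rho : forall i, S -> 'M[R[i]]_(d i))
          (P : 'I_#|conj_classes S| -> {mpoly R[i][#|S|]}),
     [/\ irr_representatives rho,
         theta S R[i] = \prod_i P i ^+ d i,
         (forall i, irreducible_elt (P i) /\ P i \is (d i).-homog),
         (forall i j (c : R[i]), P i = c *: P j -> i = j)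
       & (forall i, determines_character (P i) (character (rho i)))])
  /\ theta S R[i] = subst (yvar R[i]) (theta_groupoid S R[i]).
Proof.
split; last exact: theta_subst_groupoid.
exact (@theta_factorization S (R[i] : closedFieldType) (Num.Theory.pchar_num _)).
Qed.
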